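(* Let $N$ be a random variable with values in $\{0,1,2,\ldots\}$ which is not almost surely equal to $0$ and not almost surely equal to $1$. Then there exists a real-valued $N$-stable random variable $X$ which is not almost surely equal to zero if and only if $1 < \mathbb E[N] < \infty$.
   Context: Definition ($N$-stability). Let $N$ be a random variable with values in $\{0,1,2,\ldots\}$. A real-valued random variable $X$ is called $N$-stable if there exists a constant $c > 0$ such that $X_1 + \ldots + X_N \stackrel{d}{=} cX$, where $X_1, X_2, \ldots$ are independent copies of $X$, independent of $N$ (the empty sum, for $N=0$, equals $0$). Here $\stackrel{d}{=}$ denotes equality in law. *)

(* Defs.v *)
From HB Require Import structures.
From mathcomp Require Import all_boot all_order all_algebra finmap.
From mathcomp Require Import all_classical all_reals all_analysis.

Set Implicit Arguments.
Unset Strict Implicit.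
Unset Printing Implicit Defensive.

Import Order.TTheory GRing.Theory Num.Theory.
Import numFieldNormedType.Exports.

Local Open Scope classical_set_scope.
Local Open Scope ring_scope.

(* Laws are compared on measurable sets only: [distribution P X] is a total
   function on sets whose values on non-measurable sets carry no meaning. *)
Definition eq_law (R : realType) (d1 d2 d3 : measure_display)
    (T1 : measurableType d1) (T2 : measurableType d2) (U : measurableType d3)
    (P1 : probability T1 R) (P2 : probability T2 R)
    (X1 : {RV P1 >-> U}) (X2 : {RV P2 >-> U}) : Prop :=
  forall A : set U, measurable A -> distribution P1 X1 A = distribution P2 X2 A.

Definition mutually_independent (R : realType) (d d' : measure_display)
    (T : measurableType d) (U : measurableType d') (P : probability T R)
    (I : choiceType) (X : I -> {RV P >-> U}) : Prop :=
  forall (J : {fset I}) (A : I -> set U),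
    (forall i, i \in J -> measurable (A i)) ->
    P (\bigcap_(i in [set` J]) (X i @^-1` A i)) =
    (\prod_(i <- J) P (X i @^-1` A i))%E.

Definition sigma_family (R : realType) (d d' : measure_display)
    (T : measurableType d) (U : measurableType d') (P : probability T R)
    (I : Type) (X : I -> {RV P >-> U}) : set (set T) :=
  <<s \bigcup_i preimage_set_system setT (X i) measurable >>.

Definition independent_of_family (R : realType) (d d' d'' : measure_display)
    (T : measurableType d) (V : measurableType d') (U : measurableType d'')
    (P : probability T R) (N : {RV P >-> V})
    (I : Type) (X : I -> {RV P >-> U}) : Prop :=
  forall (B : set V) (E : set T), measurable B -> sigma_family X E ->
    P (N @^-1` B `&` E) = (P (N @^-1` B) * P E)%E.

(* X_1 + ... + X_N, the sequence being indexed from 0 *)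
Definition random_sum (R : realType) (d : measure_display)
    (T : measurableType d) (P : probability T R)
    (N : {RV P >-> nat}) (X : nat -> {RV P >-> R}) (t : T) : R :=
  \sum_(i < N t) X i t.

Lemma measurable_random_sum (R : realType) (d : measure_display)
    (T : measurableType d) (P : probability T R)
    (N : {RV P >-> nat}) (X : nat -> {RV P >-> R}) :
  measurable_fun setT (random_sum N X).
Proof.
move=> _ A mA; rewrite setTI.
rewrite (_ : _ @^-1` _ = \bigcup_n ((N @^-1` [set n]) `&`
    ((fun t => \sum_(i < n) X i t) @^-1` A))); last first.
  apply/seteqP; split=> [t At|t [n _ [/= <-]]//].
  by exists (N t).
apply: bigcupT_measurable => n; apply: measurableI.
  by rewrite -[X in measurable X]setTI; exact: measurable_funP.
rewrite -[X in measurable X]setTI.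
have mS : measurable_fun setT (fun t => \sum_(i < n) X i t).
  by apply: measurable_sum => i; exact: measurable_funP.
exact: mS.
Qed.

HB.instance Definition _ (R : realType) (d : measure_display)
    (T : measurableType d) (P : probability T R)
    (N : {RV P >-> nat}) (X : nat -> {RV P >-> R}) :=
  isMeasurableFun.Build _ _ _ _ (random_sum N X) (measurable_random_sum N X).

(* The probability space of [N] may be too small to carry the copies of [X], so
   the random sum is formed on some space [T] that carries a copy [M] of [N]
   and copies [Y i] of [X] with the required independence; the law of the sum
   does not depend on that space. *)
Definition N_stable (R : realType) (dN dX : measure_display)
    (TN : measurableType dN) (TX : measurableType dX)
    (PN : probability TN R) (PX : probability TX R)
    (N : {RV PN >-> nat}) (X : {RV PX >-> R}) : Prop :=
  exists2 c : R, 0 < c &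
  exists (d : measure_display) (T : measurableType d) (P : probability T R)
      (M : {RV P >-> nat}) (Y : nat -> {RV P >-> R}),
    [/\ eq_law M N,
        forall i, eq_law (Y i) X,
        mutually_independent Y,
        independent_of_family M Y &
        eq_law (random_sum M Y : {RV P >-> R})
               (c *: (X : {mfun TX >-> R}) : {RV PX >-> R})].

(* Main.v *)
From HB Require Import structures.
Require Import Defs.
From mathcomp Require Import all_boot all_order all_algebra finmap.
From mathcomp Require Import all_classical all_reals all_analysis.
From mathcomp Require Import measurable_realfun ring lra.

(* Write [f] for the generating function of [N].

   If [X] is [N]-stable with constant [c], then [p = P(X = 0)] satisfies
   [f(p) <= p], which for [E[N] <= 1] forces [p = 1] or [N = 1].  If
   [E[N] = +oo] then [(1 - f(s)) / (1 - s)] tends to [+oo] as [s -> 1], whereas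
   the characteristic function [phi] satisfies [|phi(c x)| <= f(|phi(x)|)] and
   [1 - |phi(2 x)|^2 <= 4 (1 - |phi(x)|^2)]; hence [|phi| = 1] along a sequence
   tending to [0], so [X] is a nonzero constant and [N] equals [c], a
   contradiction.

   If [1 < m = E[N] < +oo], let [Z_n] be a Galton-Watson process with offspring
   law [N], and choose [h_n] increasing to [1] with [f(h_{n+1}) = h_n].  Then
   [h_n ^ Z_n] is a bounded martingale (the Seneta-Heyde normalization); its
   limit is almost surely positive and [X], minus the logarithm of this limit,
   satisfies [m X = X_1 + ... + X_N] almost surely, where [X_i] is the copy of
   [X] attached to the [i]-th subtree. *)

Set Implicit Arguments.
Unset Strict Implicit.
Unset Printing Implicit Defensive.

Import Order.TTheory GRing.Theory Num.Theory.
Import numFieldNormedType.Exports.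

Local Open Scope classical_set_scope.
Local Open Scope ring_scope.

(** * Bounded random variables *)

(** With only [E[N]] finite, [Z_n / m ^ n] may tend to [0]. By contrast [h_n ^ Z_n] has constant
    mean [h_0], strictly between [0] and [1], so its limit [L] is neither almost surely [0] nor
    almost surely [1]. The equation for [X] comes from [ln h_n / ln h_{n+1} -> m], which turns the
    normalization of generation [n + 1] of a tree into that of generation [n] of its subtrees.
    Positivity of [L] is a fixed point argument: [p = P(L > 0)] satisfies [E[L] <= p <= f(p)], while
    [f(s) < s] on [[E[L], 1)]. Convergence is obtained in mean square, the mixed second moments
    being explicit iterates of [f]. A sparse subsequence then converges almost surely together with
    its shift by one generation; both are needed, since the recursion links consecutive generations.
    The space of coin tosses contains two independent copies of itself, so a whole tree, with its
    subtrees and a copy of [N], is read off one sequence of bits. In the converse, [|phi|^2] is the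
    characteristic function of the difference of two independent copies of [X]: hence the doubling
    inequality, and hence the almost sure equality of the two copies once [|phi| = 1] near [0]. *)

Section bounded_measurable.
Context d (T : measurableType d) (R : realType).

(** Expectations are taken of bounded functions wherever possible: they are then real numbers, and
    integrability reduces to the closure properties below. *)
Definition bounded_measurable (f : T -> R) :=
  measurable_fun setT f /\ exists K : R, forall t, `|f t| <= K.

Implicit Types f g : T -> R.

Lemma bm_cst r : bounded_measurable (fun=> r).
Proof. by split; [exact: measurable_cst|exists `|r|]. Qed.

Lemma bm_bound f (K : R) : measurable_fun setT f -> (forall t, `|f t| <= K) ->
  bounded_measurable f.
Proof. by move=> mf fK; split=> //; exists K. Qed.

Lemma bmD f g : bounded_measurable f -> bounded_measurable g ->
  bounded_measurable (fun t => f t + g t).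
Proof.
move=> [mf [K fK]] [mg [L gL]]; split; first exact: measurable_funD.
by exists (K + L) => t; rewrite (le_trans (ler_normD _ _))// lerD.
Qed.

Lemma bmM f g : bounded_measurable f -> bounded_measurable g ->
  bounded_measurable (fun t => f t * g t).
Proof.
move=> [mf [K fK]] [mg [L gL]]; split; first exact: measurable_funM.
by exists (K * L) => t; rewrite normrM ler_pM.
Qed.

Lemma bmB f g : bounded_measurable f -> bounded_measurable g ->
  bounded_measurable (fun t => f t - g t).
Proof.
move=> [mf [K fK]] [mg [L gL]]; split; first exact: measurable_funB.
by exists (K + L) => t; rewrite (le_trans (ler_normB _ _))// lerD.
Qed.

Lemma bmX f n : bounded_measurable f -> bounded_measurable (fun t => f t ^+ n).
Proof.
move=> bf; elim: n => [|n IH]; first exact: bm_cst.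
by under eq_fun do rewrite exprS; exact: bmM.
Qed.

Lemma bm_norm f : bounded_measurable f -> bounded_measurable (fun t => `|f t|).
Proof.
move=> [mf [K fK]]; split; first exact: measurableT_comp.
by exists K => t; rewrite normr_id.
Qed.

Lemma bm_prod I (r : seq I) (F : I -> T -> R) :
  (forall i, bounded_measurable (F i)) ->
  bounded_measurable (fun t => \prod_(i <- r) F i t).
Proof.
move=> bF; elim: r => [|i r IH].
  by under eq_fun do rewrite big_nil; exact: bm_cst.
by under eq_fun do rewrite big_cons; exact: bmM.
Qed.

Lemma bm_indic (A : set T) : measurable A -> bounded_measurable (\1_A : T -> R).
Proof.
move=> mA; split; first exact: measurable_indic.
by exists 1 => t; rewrite ger0_norm indicE// lern1; case: (_ \in _).
Qed.

Lemma bm_comp d' (U : measurableType d') (g : T -> U) (h : U -> R) (K : R) :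
  measurable_fun setT h -> (forall u, `|h u| <= K) -> measurable_fun setT g ->
  bounded_measurable (h \o g).
Proof. by move=> mh hK mg; split; [exact: measurableT_comp|exists K => t; exact: hK]. Qed.

End bounded_measurable.

(** * Expectations of bounded random variables *)

Section expectation_bounded.
Context d (T : measurableType d) (R : realType) (P : probability T R).
Implicit Types f g : T -> R.

Lemma bm_integrable f : bounded_measurable f -> P.-integrable setT (EFin \o f).
Proof.
move=> [mf [K fK]]; apply: measurable_bounded_integrable => //.
  by rewrite (le_lt_trans (probability_le1 _ _))// ltry.
exists K; split; first by rewrite num_real.
by move=> M KM t _; exact: le_trans (fK t) (ltW KM).
Qed.

Lemma bm_EFin f : bounded_measurable f ->
  ((\int[P]_t f t)%:E = \int[P]_t (f t)%:E)%E.
Proof.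
by move=> /bm_integrable bf; rewrite /Rintegral fineK//; exact: integrable_fin_num.
Qed.

Lemma bexp_cst r : \int[P]_t r = r.
Proof. by rewrite Rintegral_cst// [X in fine X]probability_setT mulr1. Qed.

Lemma bexpD f g : bounded_measurable f -> bounded_measurable g ->
  \int[P]_t (f t + g t) = \int[P]_t f t + \int[P]_t g t.
Proof. by move=> bf bg; rewrite RintegralD//; exact: bm_integrable. Qed.

Lemma bexpB f g : bounded_measurable f -> bounded_measurable g ->
  \int[P]_t (f t - g t) = \int[P]_t f t - \int[P]_t g t.
Proof. by move=> bf bg; rewrite RintegralB//; exact: bm_integrable. Qed.

Lemma bexpZ r f : bounded_measurable f -> \int[P]_t (r * f t) = r * \int[P]_t f t.
Proof. by move=> bf; rewrite RintegralZl//; exact: bm_integrable. Qed.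

Lemma bexp_sum (I : Type) (s : seq I) (Q : pred I) (F : I -> T -> R) :
  (forall i, bounded_measurable (F i)) ->
  \int[P]_t (\sum_(i <- s | Q i) F i t) = \sum_(i <- s | Q i) \int[P]_t F i t.
Proof.
move=> bF; suff [] : bounded_measurable (fun t => \sum_(i <- s | Q i) F i t) /\
  \int[P]_t (\sum_(i <- s | Q i) F i t) = \sum_(i <- s | Q i) \int[P]_t F i t by [].
elim: s => [|i s [bs IH]].
  rewrite big_nil; under eq_Rintegral do rewrite big_nil.
  by rewrite bexp_cst; split => //; under eq_fun do rewrite big_nil; exact: bm_cst.
rewrite big_cons; under eq_Rintegral do rewrite big_cons.
have -> : (fun t => \sum_(j <- i :: s | Q j) F j t) =
    (fun t => if Q i then F i t + \sum_(j <- s | Q j) F j t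
              else \sum_(j <- s | Q j) F j t).
  by apply/funext => t; rewrite big_cons.
case: (Q i); split => //; first exact: bmD.
by rewrite bexpD// IH.
Qed.

Lemma bexp_le f g : bounded_measurable f -> bounded_measurable g ->
  (forall t, f t <= g t) -> \int[P]_t f t <= \int[P]_t g t.
Proof. by move=> bf bg fg; apply: le_Rintegral => //; exact: bm_integrable. Qed.

Lemma bexp_ae f g : bounded_measurable f -> bounded_measurable g ->
  {ae P, forall t, f t = g t} -> \int[P]_t f t = \int[P]_t g t.
Proof.
move=> [mf _] [mg _] fg; congr fine; apply: ae_eq_integral => //.
- exact/measurable_EFinP.
- exact/measurable_EFinP.
- by apply: filterS fg => t -> _.
Qed.

Lemma bexp_eq0_ae f : bounded_measurable f -> (forall t, 0 <= f t) ->
  \int[P]_t f t = 0 -> {ae P, forall t, f t = 0}.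
Proof.
move=> bf f0 If0.
have : ae_eq P setT (EFin \o f) (cst 0%E).
  apply/ae_eq_integral_abs => //; first exact/measurable_EFinP/bf.1.
  transitivity (\int[P]_t (f t)%:E)%E.
    by apply: eq_integral => t _ /=; rewrite ger0_norm.
  by rewrite -bm_EFin// If0.
by apply: filterS => t /(_ I) /= [].
Qed.

Lemma bexp_indic (A : set T) : measurable A -> \int[P]_t \1_A t = fine (P A).
Proof. by move=> mA; rewrite /Rintegral integral_indic// setIT. Qed.

Lemma bexp_cvg (F : nat -> T -> R) f (K : R) :
  (forall n, measurable_fun setT (F n)) -> measurable_fun setT f ->
  (forall n t, `|F n t| <= K) ->
  {ae P, forall t, F n t @[n --> \oo] --> f t} ->
  \int[P]_t F n t @[n --> \oo] --> \int[P]_t f t.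
Proof.
move=> mF mf FK Ff.
have iK : P.-integrable setT (EFin \o (fun=> K) : T -> \bar R).
  by apply: bm_integrable; exact: bm_cst.
have [i1 _ i2] := @dominated_convergence _ T R P setT measurableT
  (fun n => EFin \o F n) (EFin \o f) (EFin \o (fun=> K))
  (fun n => proj2 (measurable_EFinP _ _) (mF n)) (proj2 (measurable_EFinP _ _) mf)
  ltac:(by apply: filterS Ff => t Ft _; by apply: cvg_EFin; [exact: nearW|exact: Ft]) iK
  ltac:(by apply: aeW => t n _ /=; rewrite lee_fin).
apply: fine_cvg; rewrite fineK; first exact: i2.
exact: integrable_fin_num.
Qed.

End expectation_bounded.

(** * Product rule for independent variables *)

Section independence.
Context d1 d2 d (T : measurableType d) (U1 : measurableType d1)
  (U2 : measurableType d2) (R : realType) (P : probability T R).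
Variables (a : {mfun T >-> U1}) (b : {mfun T >-> U2}).
Hypothesis indep : forall A B, measurable A -> measurable B ->
  P (a @^-1` A `&` b @^-1` B) = (P (a @^-1` A) * P (b @^-1` B))%E.

(** Independence says that the law of the pair agrees with the product of the laws on rectangles,
    hence everywhere; Tonelli does the rest. *)
Lemma ge0_integral_indep (u : U1 -> \bar R) (v : U2 -> \bar R) :
  measurable_fun setT u -> measurable_fun setT v ->
  (forall x, 0 <= u x)%E -> (forall x, 0 <= v x)%E ->
  (\int[P]_t (u (a t) * v (b t)) =
   \int[P]_t u (a t) * \int[P]_t v (b t))%E.
Proof.
move=> mu mv u0 v0.
have mc : measurable_fun setT (fun t => (a t, b t)) by exact: measurable_fun_pair.
pose c : {mfun T >-> (U1 * U2)%type} := mfun_Sub (mem_set mc).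
pose w (z : U1 * U2) := (u z.1 * v z.2)%E.
have mw : measurable_fun setT w.
  by apply: emeasurable_funM; apply: measurableT_comp.
have w0 z : (0 <= w z)%E by rewrite mule_ge0.
transitivity (\int[distribution P c]_z w z)%E.
  by rewrite ge0_integral_distribution.
have cE A : measurable A -> A `<=` setT ->
    distribution P c A = (distribution P a \x distribution P b)%E A.
  by move=> mA _; apply/esym; apply: product_measure_unique.
rewrite (eq_measure_integral _ cE).
rewrite fubini_tonelli1// /fubini_F /w /=.
under eq_integral => x _.
  rewrite ge0_integralZl//; over.
rewrite /= ge0_integralZr//; last exact: integral_ge0.
by rewrite !ge0_integral_distribution.
Qed.

Lemma bexp_indep_mfun (u : U1 -> R) (v : U2 -> R) :
  bounded_measurable u -> bounded_measurable v ->
  \int[P]_t (u (a t) * v (b t)) = \int[P]_t u (a t) * \int[P]_t v (b t).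
Proof.
move=> [mu [K uK]] [mv [L vL]].
have bua : bounded_measurable (u \o a) by apply: bm_comp uK _.
have bvb : bounded_measurable (v \o b) by apply: bm_comp vL _.
have buvK : bounded_measurable (fun t => u (a t) + K).
  by apply: bmD => //; exact: bm_cst.
have bvL : bounded_measurable (fun t => v (b t) + L).
  by apply: bmD => //; exact: bm_cst.
have bK (r : R) : bounded_measurable (fun _ : T => r) by exact: bm_cst.
have u0 x : 0 <= u x + K.
  by have := uK x; rewrite ler_norml -subr_ge0 opprK addrC => /andP[].
have v0 x : 0 <= v x + L.
  by have := vL x; rewrite ler_norml -subr_ge0 opprK addrC => /andP[].
(* Adding the bounds makes both factors nonnegative; the product rule for [u] and [v] is recovered
   by expanding. *)
have : \int[P]_t ((u (a t) + K) * (v (b t) + L)) =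
    \int[P]_t (u (a t) + K) * \int[P]_t (v (b t) + L).
  apply: EFin_inj; rewrite EFinM !bm_EFin//; last exact: bmM.
  under eq_integral do rewrite EFinM.
  rewrite (@ge0_integral_indep (fun x => (u x + K)%:E) (fun x => (v x + L)%:E))//.
  - by apply/measurable_EFinP; apply: measurable_funD.
  - by apply/measurable_EFinP; apply: measurable_funD.
rewrite !bexpD// !bexp_cst.
have -> : (fun t => (u (a t) + K) * (v (b t) + L)) =
    (fun t => (u (a t) * v (b t) + L * u (a t)) + (K * v (b t) + K * L)).
  by apply/funext => t; ring.
have b1 : bounded_measurable (fun t => u (a t) * v (b t)) by exact: bmM.
have b2 : bounded_measurable (fun t => L * u (a t)).
  by apply: bmM => //; exact: bm_cst.
have b3 : bounded_measurable (fun t => K * v (b t)).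
  by apply: bmM => //; exact: bm_cst.
have b4 : bounded_measurable (fun t : T => K * L) by exact: bm_cst.
rewrite !bexpD//; try exact: bmD.
rewrite !bexpZ// !bexp_cst; lra.
Qed.

End independence.

Lemma bexp_law d1 d2 d (T1 : measurableType d1) (T2 : measurableType d2)
    (U : measurableType d) (R : realType) (P1 : probability T1 R)
    (P2 : probability T2 R) (X1 : {RV P1 >-> U}) (X2 : {RV P2 >-> U}) (h : U -> R) :
  eq_law X1 X2 -> bounded_measurable h ->
  \int[P1]_t h (X1 t) = \int[P2]_t h (X2 t).
Proof.
move=> X12 [mh [K hK]]; congr fine.
rewrite -(@integral_distribution _ _ _ _ _ P1 X1 (EFin \o h)).
- rewrite -(@integral_distribution _ _ _ _ _ P2 X2 (EFin \o h)).
  + by apply: eq_measure_integral => A mA _; exact: X12.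
  + exact/measurable_EFinP.
  + apply: (@bm_integrable _ _ _ P2 (h \o X2)); exact: bm_comp hK _.
- exact/measurable_EFinP.
- apply: (@bm_integrable _ _ _ P1 (h \o X1)); exact: bm_comp hK _.
Qed.

(** * Sequences evaluated at a random index *)

Section random_index.
Context d (T : measurableType d) (R : realType).
Variables (M : T -> nat) (F : nat -> T -> R) (K : R).
Hypotheses (mM : measurable_fun setT M) (mF : forall n, measurable_fun setT (F n))
  (FK : forall n t, `|F n t| <= K).

Lemma measurable_index n : measurable (M @^-1` [set n]).
Proof. by rewrite -[X in measurable X]setTI; exact: mM. Qed.

(** The restriction of [F (M t) t] to [M t < k], written as a finite sum so that linearity applies;
    bounded convergence then removes the truncation. *)
Let S k t := \sum_(n < k) \1_(M @^-1` [set (n : nat)]) t * F n t.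

Let SE k t : S k t = if (M t < k)%N then F (M t) t else 0.
Proof.
rewrite /S; case: ltnP => [Mk|kM].
  rewrite (bigD1 (Ordinal Mk))//= big1 => [|i iM].
    by rewrite addr0 indicE mem_set// mul1r.
  rewrite indicE memNset ?mul0r//= => Mi; move: iM.
  by rewrite -(inj_eq val_inj)/= Mi eqxx.
rewrite big1// => i _; rewrite indicE memNset ?mul0r//= => Mi.
by have := ltn_ord i; rewrite -Mi ltnNge kM.
Qed.

Let bmS k : bounded_measurable (S k).
Proof.
split.
  apply: measurable_sum => i; apply: measurable_funM => //.
  exact/measurable_indic/measurable_index.
exists `|K| => t; rewrite SE; case: ifP => _; last by rewrite normr0.
by rewrite (le_trans (FK _ _))// ler_norm.
Qed.

Lemma random_index_lim t : S k t @[k --> \oo] --> F (M t) t.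
Proof.
apply: cvg_near_cst; near=> k; rewrite SE.
by rewrite ifT//; near: k; exact: nbhs_infty_gt.
Unshelve. all: end_near. Qed.

Lemma bm_random_index : bounded_measurable (fun t => F (M t) t).
Proof.
split; last by exists K => t; exact: FK.
apply: (@measurable_fun_cvg _ _ _ _ (fun k => S k)).
  by move=> k; have [] := bmS k.
by move=> t _; exact: random_index_lim.
Qed.

Lemma bexp_random_index_cvg (P : probability T R) :
  \sum_(n < k) \int[P]_t (\1_(M @^-1` [set (n : nat)]) t * F n t) @[k --> \oo]
    --> \int[P]_t F (M t) t.
Proof.
rewrite (_ : (fun k => _) = fun k => \int[P]_t S k t); last first.
  apply/funext => k; rewrite bexp_sum// => n; apply: bmM; last by split => //; exists K.
  exact/bm_indic/measurable_index.
apply: (@bexp_cvg _ _ _ _ _ _ `|K|).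
- by move=> n; case: (bmS n).
- by case: bm_random_index.
- move=> n t; rewrite SE; case: ifP => _; last by rewrite normr0.
  by rewrite (le_trans (FK _ _))// ler_norm.
- by apply: aeW => t; exact: random_index_lim.
Qed.

End random_index.

(* The two sides may live on different probability spaces: this is how the
   law of a random sum is compared with an expectation over [N] alone. *)
Lemma bexp_random_index d d' (T : measurableType d) (T' : measurableType d')
  (R : realType) (P : probability T R) (P' : probability T' R)
  (M : T -> nat) (M' : T' -> nat) (F : nat -> T -> R) (G : nat -> T' -> R) (K : R) :
  measurable_fun setT M -> measurable_fun setT M' ->
  (forall n, measurable_fun setT (F n)) -> (forall n, measurable_fun setT (G n)) ->
  (forall n t, `|F n t| <= K) -> (forall n t, `|G n t| <= K) ->
  (forall n, \int[P]_t (\1_(M @^-1` [set n]) t * F n t) =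
             \int[P']_t (\1_(M' @^-1` [set n]) t * G n t)) ->
  \int[P]_t F (M t) t = \int[P']_t G (M' t) t.
Proof.
move=> mM mM' mF mG FK GK FG.
have cF := bexp_random_index_cvg mM mF FK (P:=P).
have cG := bexp_random_index_cvg mM' mG GK (P:=P').
suff E : (fun k => \sum_(n < k) \int[P]_t (\1_(M @^-1` [set (n : nat)]) t * F n t)) =
    (fun k => \sum_(n < k) \int[P']_t (\1_(M' @^-1` [set (n : nat)]) t * G n t)).
  by rewrite E in cF; apply: (cvg_unique _ cF cG).
by apply/funext => k; apply: eq_bigr => i _; exact: FG.
Qed.

(** * Generating functions *)

Lemma geometric_sumE (R : pzRingType) (s : R) n :
  1 - s ^+ n = (1 - s) * \sum_(i < n) s ^+ i.
Proof.
rewrite -opprB subrX1 -mulNr opprB.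
by [].
Qed.

Section pgf.
Context d (T : measurableType d) (R : realType) (P : probability T R).
Variable N : {RV P >-> nat}.

Definition pgf (s : R) : R := \int[P]_t s ^+ N t.

Lemma measurable_comp_nat (h : nat -> R) :
  measurable_fun setT ((fun t => h (N t)) : T -> R).
Proof. exact: (measurableT_comp (f := h)). Qed.

Lemma bm_comp_nat (h : nat -> R) (K : R) : (forall n, `|h n| <= K) ->
  bounded_measurable (fun t : T => h (N t)).
Proof. by move=> hK; apply: bm_bound (fun t => hK (N t)); exact: measurable_comp_nat. Qed.

Lemma normr_exp_le1 (s : R) n : 0 <= s <= 1 -> `|s ^+ n| <= 1.
Proof. by move=> /andP[s0 s1]; rewrite ger0_norm ?exprn_ge0// exprn_ile1. Qed.

Lemma bm_pgf (s : R) : 0 <= s <= 1 -> bounded_measurable (fun t : T => s ^+ N t).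
Proof. by move=> s01; apply: (@bm_comp_nat (fun n => s ^+ n) 1) => n; exact: normr_exp_le1. Qed.

Lemma pgf1 : pgf 1 = 1.
Proof. by rewrite /pgf; under eq_Rintegral do rewrite expr1n; rewrite bexp_cst. Qed.

Lemma pgf_ge0 s : 0 <= s -> 0 <= pgf s.
Proof. by move=> s0; apply: Rintegral_ge0 => t _; rewrite exprn_ge0. Qed.

Lemma pgf_le1 s : 0 <= s <= 1 -> pgf s <= 1.
Proof.
move=> s01; rewrite -[leRHS](bexp_cst P); apply: bexp_le.
- exact: bm_pgf.
- exact: bm_cst.
- by move=> t; rewrite (le_trans (ler_norm _))// normr_exp_le1.
Qed.

Let geom_le (s : R) n k : 0 <= s <= 1 -> (n <= k)%N ->
  n%:R * s ^+ k <= \sum_(i < n) s ^+ i.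
Proof.
move=> /andP[s0 s1] nk; rewrite mulr_natl -[X in _ *+ X](card_ord n) -sumr_const.
apply: ler_sum => i _; apply: ler_wiXn2l => //.
by rewrite (leq_trans (ltnW (ltn_ord i))).
Qed.

(** With [j = minn n k], the quantity [1 - s ^+ j] is [1 - s] times [j] powers of [s], each at least
    [s ^+ k]. The truncation at [k] makes the factor [s ^+ k] uniform in [n]. *)
Let trunc_le (s : R) n k : 0 <= s <= 1 ->
  (1 - s) * ((minn n k)%:R * s ^+ k) <= 1 - s ^+ n.
Proof.
move=> /andP[s0 s1]; rewrite (@le_trans _ _ (1 - s ^+ (minn n k)))//.
  rewrite geometric_sumE ler_wpM2l ?subr_ge0//.
  by apply: geom_le; rewrite ?s0// geq_minr.
by rewrite lerB// ler_wiXn2l// geq_minl.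
Qed.

(** Monotone convergence of the truncations, which covers an infinite expectation as well. *)
Let expectation_trunc (A : R) : (A%:E < 'E_P[fun t => (N t)%:R : R])%E ->
  exists k, A < \int[P]_t (minn (N t) k)%:R.
Proof.
rewrite unlock => AN.
pose g k t : \bar R := ((minn (N t) k)%:R : R)%:E.
have cg : (\int[P]_t g k t)%E @[k --> \oo] --> (\int[P]_t limn (g ^~ t))%E.
  apply: cvg_monotone_convergence => //.
  - by move=> k; apply/measurable_EFinP; exact: (@measurable_comp_nat (fun n => (minn n k)%:R)).
  - by move=> k t _; rewrite lee_fin.
  - move=> t _ i j ij; rewrite lee_fin ler_nat leq_min geq_minl/=.
    by rewrite (leq_trans (geq_minr _ _)).
have gE t : limn (g ^~ t) = ((N t)%:R : R)%:E.
  apply/cvg_lim => //; apply: cvg_near_cst; near=> k.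
  rewrite /g (minn_idPl _)//; near: k; exact: nbhs_infty_ge.
rewrite (eq_integral (fun t => ((N t)%:R : R)%:E)) in cg; last by move=> t _; exact: gE.
have [k _ /(_ k (leqnn k))] := cg _ (open_ereal_gt' AN).
rewrite /= => Ak; exists k; rewrite -lte_fin bm_EFin//.
apply: (@bm_comp_nat (fun n => (minn n k)%:R) k%:R) => n.
by rewrite ger0_norm// ler_nat geq_minr.
Unshelve. all: end_near. Qed.

(** A one-sided form of [f'(1) = E[N]] that makes sense for [E[N] = +oo]. It serves both directions
    of the theorem. *)
Lemma pgf_slope (A : R) : (A%:E < 'E_P[fun t => (N t)%:R : R])%E ->
  exists2 s0, 0 <= s0 < 1 & forall s, s0 <= s <= 1 -> A * (1 - s) <= 1 - pgf s.
Proof.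
move=> /expectation_trunc[k Ak]; set e := (X in _ < X) in Ak.
have e0 : 0 <= e by exact: Rintegral_ge0.
(* For [1 - s <= D], Bernoulli gives [e * s ^+ k >= e - D * k * e], and this is at least [A] by the
   choice of [D]. The [+ 1] keeps the denominator positive when [k * e = 0]; the minimum with [1]
   keeps [1 - D] nonnegative. *)
pose D := Num.min 1 ((e - A) / (k%:R * e + 1)).
have ke : 0 < k%:R * e + 1 by rewrite ltr_wpDl// mulr_ge0.
have D0 : 0 < D by rewrite lt_min ltr01 divr_gt0// subr_gt0.
have D1 : D <= 1 by rewrite ge_min lexx.
have De : D * (k%:R * e) <= e - A.
  rewrite (@le_trans _ _ ((e - A) / (k%:R * e + 1) * (k%:R * e)))//.
    by rewrite ler_wpM2r ?mulr_ge0// ge_min lexx orbT.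
  rewrite mulrAC ler_pdivrMr// ler_wpM2l ?lerDl// subr_ge0 ltW//.
exists (1 - D); first by rewrite subr_ge0 D1 ltrBlDr ltrDl.
move=> s /andP[Ds s1].
have s0 : 0 <= s by rewrite (le_trans _ Ds)// subr_ge0.
have bm1 : bounded_measurable (fun t => s ^+ N t) by apply: bm_pgf; rewrite s0.
have bm2 : bounded_measurable (fun t => (minn (N t) k)%:R : R).
  apply: (@bm_comp_nat (fun n => (minn n k)%:R) k%:R) => n.
  by rewrite ger0_norm// ler_nat geq_minr.
have : \int[P]_t (((1 - s) * s ^+ k) * (minn (N t) k)%:R) <= \int[P]_t (1 - s ^+ N t).
  apply: bexp_le.
  - by apply: bmM => //; exact: bm_cst.
  - by apply: bmB => //; exact: bm_cst.
  - by move=> t; rewrite -mulrA (mulrC (s ^+ k)) trunc_le// s0.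
rewrite bexpZ// bexpB//; last exact: bm_cst.
rewrite bexp_cst -/e; apply: le_trans.
rewrite mulrC -mulrA ler_wpM2l ?subr_ge0//.
have bern : 1 - k%:R * (1 - s) <= s ^+ k.
  have s1' : 0 <= 1 - s by rewrite subr_ge0.
  have : 1 - s ^+ k <= k%:R * (1 - s).
    rewrite geometric_sumE mulrC ler_wpM2r//.
    rewrite -[leRHS]mulr1 mulr_natl -[X in _ *+ X](card_ord k) -sumr_const.
    by apply: ler_sum => i _; rewrite exprn_ile1.
  lra.
apply: le_trans (ler_wpM2r e0 bern).
have : (1 - s) * (k%:R * e) <= D * (k%:R * e).
  by rewrite ler_wpM2r ?mulr_ge0//; lra.
nra.
Qed.

(** [s ^+ n - s' ^+ n] is [s - s'] times a sum of [n] products of absolute value at most [1]. This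
    yields continuity and the upper bound on the slope that complements [pgf_slope]. *)
Lemma pgf_lipschitz (m : R) : ('E_P[fun t => (N t)%:R : R] = m%:E)%E ->
  forall s s', 0 <= s <= 1 -> 0 <= s' <= 1 -> `|pgf s - pgf s'| <= m * `|s - s'|.
Proof.
rewrite unlock => Em s s' s01 s'01.
have bs := bm_pgf s01; have bs' := bm_pgf s'01.
rewrite -bexpB// (le_trans (le_normr_Rintegral _ _))//.
  by apply: bm_integrable; exact: bmB.
rewrite -lee_fin bm_EFin; last by apply: bm_norm; exact: bmB.
rewrite EFinM -Em -ge0_integralZr//.
- apply: ge0_le_integral => //.
  + by apply/measurable_EFinP; case: (bm_norm (bmB bs bs')).
  + apply/measurable_EFinP.
    exact: (@measurable_comp_nat (fun n => n%:R * `|s - s'|)).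
  + move=> t _; rewrite -EFinM lee_fin subrXX normrM mulrC ler_wpM2r//.
    rewrite (le_trans (ler_norm_sum _ _ _))//.
    rewrite -[leRHS]mulr1 mulr_natl -[X in _ *+ X](card_ord (N t)) -sumr_const.
    apply: ler_sum => i _; rewrite normrM -[leRHS]mulr1.
    by rewrite ler_pM// normr_exp_le1.
- exact/measurable_EFinP/(@measurable_comp_nat (fun n => n%:R)).
Qed.

(** Put [g n = (1 - p ^+ n) / (1 - p)], so that [g n <= n] with equality only for [n <= 1]. The
    assumption [pgf p <= p] reads [1 <= E[g(N)]], so [E[N] <= 1] forces [N = g(N)], that is
    [N <= 1], almost surely. *)
Lemma pgf_fixed_subcritical (p : R) : 0 <= p < 1 -> pgf p <= p ->
  ('E_P[fun t => (N t)%:R : R] <= 1)%E -> {ae P, forall t, N t = 1%N}.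
Proof.
move=> /andP[p0 p1] fp; rewrite unlock => EN.
have p01 : 0 <= p <= 1 by rewrite p0 ltW.
have q0 : 0 < 1 - p by rewrite subr_gt0.
pose g n : R := \sum_(i < n) p ^+ i.
have gE n : g n = (1 - p)^-1 * (1 - p ^+ n).
  by rewrite geometric_sumE mulKf ?gt_eqF.
have bg : bounded_measurable (fun t => g (N t)).
  apply: (@bm_comp_nat g (1 - p)^-1) => n; rewrite gE normrM gtr0_norm ?invr_gt0//.
  have := exprn_ge0 n p0; have : p ^+ n <= 1 by rewrite exprn_ile1// ltW.
  move=> p1' p0'; rewrite ler_piMr ?invr_ge0 ?(ltW q0)// ger0_norm ?subr_ge0//.
  by rewrite lerBlDr lerDl.
have gN n : g n <= n%:R.
  rewrite -[leRHS]mulr1 mulr_natl -[X in _ *+ X](card_ord n) -sumr_const.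
  by apply: ler_sum => i _; rewrite exprn_ile1// ltW.
(* From two terms on, the geometric sum contains [p < 1], so the inequality is strict. *)
have gN2 n : g n.+2 < n.+2%:R.
  rewrite /g 2!big_ord_recl/= expr0 expr1.
  rewrite (@lt_le_trans _ _ (1 + (1 + \sum_(i < n) 1)))//.
    rewrite ltrD2l; apply: ltr_leD => //.
    by apply: ler_sum => i _; rewrite exprn_ile1// ltW.
  by rewrite sumr_const card_ord -[n.+2%:R]/((2 + n)%:R) natrD; lra.
have Eg : 1 <= \int[P]_t g (N t).
  under eq_Rintegral do rewrite gE.
  rewrite bexpZ; last by apply: bmB; [exact: bm_cst|exact: bm_pgf].
  rewrite bexpB//; [|exact: bm_cst|exact: bm_pgf].
  rewrite bexp_cst mulrC ler_pdivlMr// mul1r lerD2l lerN2//.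
(* A nonnegative variable whose mean is at most [1 - 1 = 0]. *)
have D0 : {ae P, forall t, (N t)%:R - g (N t) = 0}.
  have mD : measurable_fun setT (fun t => ((N t)%:R - g (N t))%:E).
    exact/measurable_EFinP/(@measurable_comp_nat (fun n => n%:R - g n)).
  have : (\int[P]_t ((N t)%:R - g (N t))%:E <= 0)%E.
    have gfin : (\int[P]_t (g (N t))%:E \is a fin_num)%E by rewrite -bm_EFin.
    rewrite -(leeD2rE _ _ gfin) add0e -ge0_integralD//.
    + under eq_integral do rewrite -EFinD subrK.
      by rewrite (le_trans EN)// -bm_EFin.
    + by move=> t _; rewrite lee_fin subr_ge0.
    + by move=> t _; rewrite lee_fin sumr_ge0// => i _; rewrite exprn_ge0.
    + by apply/measurable_EFinP; case: bg.
  rewrite le_eqVlt => /orP[/eqP I0|]; last first.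
    by rewrite ltNge integral_ge0// => t _; rewrite lee_fin subr_ge0.
  have : ae_eq P setT (fun t => ((N t)%:R - g (N t))%:E) (cst 0%E).
    apply/ae_eq_integral_abs => //; rewrite -[RHS]I0.
    by apply: eq_integral => t _ /=; rewrite ger0_norm// subr_ge0.
  by apply: filterS => t /(_ I) /= [].
have N1 : {ae P, forall t, (N t <= 1)%N}.
  apply: filterS D0 => t; case: (N t) => [//|[//|n]] /eqP.
  by rewrite subr_eq0 gt_eqF.
have bh : bounded_measurable (fun t => (N t == 0%N)%:R : R).
  apply: (@bm_comp_nat (fun n => (n == 0%N)%:R) 1) => n.
  by rewrite ger0_norm// lern1; case: (n == 0%N).
have : {ae P, forall t, (N t == 0%N)%:R = 0 :> R}.
  apply: bexp_eq0_ae => //.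
  apply/eqP; rewrite eq_le Rintegral_ge0// andbT.
  (* [g 0 = 0] and [g 1 = 1], so [1 - g (N t)] is the indicator of [N t = 0] as soon as
     [N t <= 1]. *)
  have <- : 1 - \int[P]_t g (N t) = \int[P]_t (N t == 0%N)%:R.
    rewrite -[X in X - _](bexp_cst P) -bexpB//; last exact: bm_cst.
    apply: bexp_ae => //; first by apply: bmB => //; exact: bm_cst.
    apply: filterS N1 => t; rewrite /g; case: (N t) => [|[|//]] _.
      by rewrite big_ord0 subr0.
    by rewrite big_ord1 expr0 subrr.
  by rewrite subr_le0.
by apply: filterS2 N1 => t; case: (N t) => [|[|]]//= _ /eqP; rewrite oner_eq0.
Qed.

End pgf.

(** * Necessity *)

(** [Q (A]&[B)] and [Q A * Q B] are finite measures in [A]; agreeing on a pi-system that contains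
    [setT], they agree on the sigma-algebra it generates. *)
Lemma indep_pi_system d (T : measurableType d) (R : realType)
    (Q : probability T R) (G : set (set T)) (B : set T) :
  G `<=` measurable -> setI_closed G -> G setT -> measurable B ->
  (forall A, G A -> Q (A `&` B) = (Q A * Q B)%E) ->
  forall A, <<s G >> A -> Q (A `&` B) = (Q A * Q B)%E.
Proof.
move=> Gm GI GT mB H A sA.
have QB : Q B = (fine (Q B))%:E by rewrite fineK// fin_num_measure.
have r0 : 0 <= fine (Q B) by rewrite fine_ge0.
have := @g_sigma_algebra_measure_unique _ R T G Gm (fun=> setT) (fun=> GT)
  (bigcup_const (P := setT) (@setT T) (ex_intro _ 0%N I))
  (mrestr Q mB) (mscale (NngNum r0) Q) GI.
move=> E; rewrite [in RHS]QB muleC; apply: E sA => //.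
- by move=> C GC; have := H C GC; rewrite [X in _ = (_ * X)%E]QB muleC.
- by move=> _; rewrite (le_lt_trans (probability_le1 _ _))// ?ltry// setTI.
Qed.

Lemma bexp_indep d1 d2 d (T : measurableType d) (U1 : measurableType d1)
  (U2 : measurableType d2) (R : realType) (P : probability T R)
  (a : T -> U1) (b : T -> U2) (u : U1 -> R) (v : U2 -> R) :
  measurable_fun setT a -> measurable_fun setT b ->
  (forall A B, measurable A -> measurable B ->
    P (a @^-1` A `&` b @^-1` B) = (P (a @^-1` A) * P (b @^-1` B))%E) ->
  bounded_measurable u -> bounded_measurable v ->
  \int[P]_t (u (a t) * v (b t)) = \int[P]_t u (a t) * \int[P]_t v (b t).
Proof.
move=> ma mb H.
exact: (@bexp_indep_mfun _ _ _ _ _ _ _ P (mfun_Sub (mem_set ma)) (mfun_Sub (mem_set mb)) H).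
Qed.

Lemma measurable_preimageT d d' (T : measurableType d) (U : measurableType d')
  (f : T -> U) (A : set U) : measurable_fun setT f -> measurable A ->
  measurable (f @^-1` A).
Proof. by move=> mf mA; rewrite -[X in measurable X]setTI; exact: mf. Qed.

(** * Partial and random sums of an independent sequence *)

Section independent_sequence.
Context d (T : measurableType d) (R : realType) (Q : probability T R).
Variable Y : nat -> {RV Q >-> R}.
Hypothesis indY : mutually_independent Y.

Lemma mutually_independent_ord n (A : nat -> set R) :
  (forall i, (i < n)%N -> measurable (A i)) ->
  Q (\bigcap_(i < n) (Y i @^-1` A i)) = (\prod_(i < n) Q (Y i @^-1` A i))%E.
Proof.
move=> mA; have := @indY (seq_fset tt (iota 0 n)) A.
have inJ i : (i \in seq_fset tt (iota 0 n)) = (i < n)%N.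
  by rewrite seq_fsetE mem_iota add0n.
have -> : [set` seq_fset tt (iota 0 n)] = `I_n.
  by apply/seteqP; split=> i /=; rewrite inJ.
move=> ->; last by move=> i; rewrite inJ; exact: mA.
rewrite (perm_big (iota 0 n)); last first.
  by rewrite (perm_trans (seq_fset_perm _ _))// undup_id ?iota_uniq.
by rewrite -[X in iota 0 X]subn0 big_mkord.
Qed.

Definition partial_sum n t : R := \sum_(i < n) Y i t.

Lemma measurable_partial_sum n : measurable_fun setT (partial_sum n).
Proof. by apply: measurable_sum => i; exact: measurable_funP. Qed.

(** A pi-system generating the sigma-algebra of the first [n] variables. *)
Let cyl n : set (set T) := [set E | exists2 A : nat -> set R,
  (forall i, measurable (A i)) & E = \bigcap_(i < n) (Y i @^-1` A i)].

Let cyl_coord n i (A : set R) : (i < n)%N -> measurable A -> cyl n (Y i @^-1` A).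
Proof.
move=> ilt mA; exists (fun j => if j == i then A else setT).
  by move=> j; case: ifP.
apply/seteqP; split => [t At j _ /=|t /(_ i ilt)]; last by rewrite /= eqxx.
by case: eqP => [->|].
Qed.

Lemma indep_partial_sum n (A B : set R) : measurable A -> measurable B ->
  Q (partial_sum n @^-1` A `&` Y n @^-1` B) =
  (Q (partial_sum n @^-1` A) * Q (Y n @^-1` B))%E.
Proof.
move=> mA mB; apply: (@indep_pi_system _ _ _ Q (cyl n)).
- move=> _ [C mC ->]; apply: bigcap_measurableType => i _.
  exact: measurable_preimageT.
- move=> _ _ [C mC ->] [D mD ->]; exists (fun i => C i `&` D i).
    by move=> i; exact: measurableI.
  by rewrite -bigcapI.
- by exists (fun=> setT) => //; apply/seteqP; split.
- exact: measurable_preimageT.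
- move=> _ [C mC ->].
  (* The event on [Y n] becomes one more side of the box, so that independence of the first [n.+1]
     variables applies to a single box. *)
  pose D i := if i == n then B else C i.
  have mD i : measurable (D i) by rewrite /D; case: ifP.
  transitivity (Q (\bigcap_(i < n.+1) (Y i @^-1` D i))).
    congr (Q _); apply/seteqP; split => [t [Ct Bt] i /= |t Dt].
      rewrite ltnS leq_eqVlt /D => /predU1P[->|ilt]; first by rewrite eqxx.
      by rewrite (ltn_eqF ilt); exact: Ct.
    split; last by have := Dt n (ltnSn n); rewrite /= /D eqxx.
    move=> i /= ilt; have := Dt i (ltnW ilt).
    by rewrite /= /D (ltn_eqF ilt).
  rewrite !mutually_independent_ord// big_ord_recr/= {2}/D eqxx; congr (_ * _)%E.
  by apply: eq_bigr => i _; rewrite /D (ltn_eqF (ltn_ord i)).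
(* Retyping the domain states measurability for the sigma-algebra generated by the cylinders, where
   the closure of measurable functions under sums is available. *)
- have mS : measurable_fun setT (partial_sum n : g_sigma_algebraType (cyl n) -> R).
    apply: measurable_sum => i _ C mC; rewrite setTI.
    by apply: sub_gen_smallest; exact: cyl_coord.
  by have := mS measurableT A mA; rewrite setTI.
Qed.

Lemma sigma_family_partial_sum n (A : set R) : measurable A ->
  sigma_family Y (partial_sum n @^-1` A).
Proof.
move=> mA; rewrite /sigma_family; set G := \bigcup_i _.
have mS : measurable_fun setT (partial_sum n : g_sigma_algebraType G -> R).
  apply: measurable_sum => i _ C mC; rewrite setTI.
  by apply: sub_gen_smallest; exists (val i) => //; exists C => //; rewrite setTI.
by have := mS measurableT A mA; rewrite setTI.
Qed.

Lemma bexp_partial_sum_indep n (u v : R -> R) :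
  bounded_measurable u -> bounded_measurable v ->
  \int[Q]_t (u (partial_sum n t) * v (Y n t)) =
  \int[Q]_t u (partial_sum n t) * \int[Q]_t v (Y n t).
Proof.
apply: bexp_indep => //; first exact: measurable_partial_sum.
exact: indep_partial_sum.
Qed.

(** Conditioning on the number of terms. *)
Lemma bexp_random_sum dN (TN : measurableType dN) (P : probability TN R)
    (N : {RV P >-> nat}) (M : {RV Q >-> nat}) (F : R -> R) :
  eq_law M N -> independent_of_family M Y -> bounded_measurable F ->
  \int[Q]_t F (random_sum M Y t) =
  \int[P]_t (fun n => \int[Q]_w F (partial_sum n w)) (N t).
Proof.
move=> MN indM bF; have [mF [K FK]] := bF.
have bFS n : bounded_measurable (fun t => F (partial_sum n t)).
  exact: bm_comp FK (measurable_partial_sum n).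
apply: (@bexp_random_index _ _ _ _ _ Q P M N (fun n t => F (partial_sum n t))
  (fun n _ => \int[Q]_w F (partial_sum n w)) K) => //.
- by move=> n; case: (bFS n).
- move=> n t; rewrite (le_trans (le_normr_Rintegral _ _))//.
    exact: bm_integrable.
  rewrite -[leRHS](bexp_cst Q); apply: bexp_le => //.
  + exact: bm_norm.
  + exact: bm_cst.
- move=> n; have b1 : bounded_measurable (\1_[set n] : nat -> R) by exact: bm_indic.
  transitivity (\int[Q]_t (\1_[set n] (M t)) * \int[Q]_t F (partial_sum n t)).
    apply: (@bexp_indep _ _ _ _ _ _ _ Q M (partial_sum n) (\1_[set n]) F) => //.
      exact: measurable_partial_sum.
    move=> A B mA mB; apply: indM => //; exact: sigma_family_partial_sum.
  rewrite (bexp_law MN b1) mulrC -bexpZ; last first.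
    by case: b1 => m1 [K1 hK1]; exact: (bm_comp m1 hK1 (measurable_funP N)).
  by under eq_Rintegral do rewrite mulrC.
Qed.

End independent_sequence.

Lemma bm_cosM (R : realType) (x : R) : bounded_measurable (fun y : R => cos (x * y)).
Proof.
apply: (@bm_bound _ _ _ _ 1) => [|y]; last exact: cos_max.
apply: (measurableT_comp (f := cos)) => //.
exact: continuous_measurable_fun (@continuous_cos R).
Qed.

Lemma bm_sinM (R : realType) (x : R) : bounded_measurable (fun y : R => sin (x * y)).
Proof.
apply: (@bm_bound _ _ _ _ 1) => [|y]; last exact: sin_max.
apply: (measurableT_comp (f := sin)) => //.
exact: continuous_measurable_fun (@continuous_sin R).
Qed.

Lemma bm_compRV d d' (T : measurableType d) (U : measurableType d') (R : realType)
  (f : T -> U) (h : U -> R) :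
  bounded_measurable h -> measurable_fun setT f -> bounded_measurable (fun t => h (f t)).
Proof. by move=> [mh [K hK]] mf; exact: (bm_comp mh hK mf). Qed.

Lemma bexp_indic1_ae d d' (T : measurableType d) (U : measurableType d')
  (R : realType) (P : probability T R) (f : T -> U) (A : set U) :
  measurable_fun setT f -> measurable A ->
  \int[P]_t (\1_A (f t) : R) = 1 <-> {ae P, forall t, A (f t)}.
Proof.
move=> mf mA.
have b1 : bounded_measurable (fun t => \1_A (f t) : R).
  by apply: bm_compRV mf; exact: bm_indic.
split => [E1|fA].
  have : {ae P, forall t, 1 - \1_A (f t) = 0 :> R}.
    apply: bexp_eq0_ae.
    - by apply: bmB => //; exact: bm_cst.
    - by move=> t; rewrite indicE subr_ge0 lern1; case: (_ \in _).
    - by rewrite bexpB//; [rewrite bexp_cst E1 subrr|exact: bm_cst].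
  apply: filterS => t; rewrite indicE; have [/set_mem//|_ /eqP] := boolP (f t \in A).
  by rewrite subr0 oner_eq0.
rewrite -[RHS](bexp_cst P); apply: bexp_ae => //; first exact: bm_cst.
by apply: filterS fA => t At; rewrite indicE mem_set.
Qed.

(** * The squared modulus of the characteristic function *)

Section characteristic_function.
Context d (T : measurableType d) (R : realType) (Q : probability T R).
Variable Y : nat -> {RV Q >-> R}.
Hypothesis indY : mutually_independent Y.
Context dX (TX : measurableType dX) (PX : probability TX R) (X : {RV PX >-> R}).
Hypothesis YX : forall i, eq_law (Y i) X.

(** Real part of the characteristic function [phi] of [X]; [esin] is the imaginary part and
    [sqr_charfun] is [|phi|^2]. *)
Definition ecos (x : R) : R := \int[PX]_t cos (x * X t).
Definition esin (x : R) : R := \int[PX]_t sin (x * X t).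
Definition sqr_charfun (x : R) : R := ecos x ^+ 2 + esin x ^+ 2.

Let acos n x := \int[Q]_t cos (x * partial_sum Y n t).
Let asin n x := \int[Q]_t sin (x * partial_sum Y n t).

Let bmS n (h : R -> R) : bounded_measurable h ->
  bounded_measurable (fun t => h (partial_sum Y n t)).
Proof. by move=> bh; apply: bm_compRV bh _; exact: measurable_partial_sum. Qed.

Let bmY n (h : R -> R) : bounded_measurable h ->
  bounded_measurable (fun t => h (Y n t)).
Proof. by move=> bh; apply: bm_compRV bh _; exact: measurable_funP. Qed.

(** The characteristic function of the sum is [phi ^ n]: the addition formulas together with
    independence perform the complex multiplication, and the modulus is multiplicative. *)
Lemma sqr_charfun_sum n x :
  (\int[Q]_t cos (x * partial_sum Y n t)) ^+ 2 +
  (\int[Q]_t sin (x * partial_sum Y n t)) ^+ 2 = sqr_charfun x ^+ n.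
Proof.
rewrite -/(acos n x) -/(asin n x).
have bc := bm_cosM x; have bs := bm_sinM x.
elim: n => [|n IH].
  rewrite /acos /asin; under eq_Rintegral do rewrite /partial_sum big_ord0 mulr0 cos0.
  rewrite bexp_cst; under eq_Rintegral do rewrite /partial_sum big_ord0 mulr0 sin0.
  by rewrite bexp_cst !expr2 mulr0 mulr1 addr0.
have cY : \int[Q]_t cos (x * Y n t) = ecos x by rewrite (bexp_law (YX n) bc).
have sY : \int[Q]_t sin (x * Y n t) = esin x by rewrite (bexp_law (YX n) bs).
have := bexp_partial_sum_indep indY n bc bc.
have := bexp_partial_sum_indep indY n bs bs.
have := bexp_partial_sum_indep indY n bc bs.
have := bexp_partial_sum_indep indY n bs bc.
rewrite cY sY -/(acos n x) -/(asin n x) => sc cs ss cc.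
have -> : acos n.+1 x = acos n x * ecos x - asin n x * esin x.
  rewrite -cc -ss -bexpB; [|by apply: bmM; [exact: (bmS _ bc)|exact: (bmY _ bc)]
                        |by apply: bmM; [exact: (bmS _ bs)|exact: (bmY _ bs)]].
  by apply: eq_Rintegral => t _; rewrite /partial_sum big_ord_recr/= mulrDr cosD.
have -> : asin n.+1 x = asin n x * ecos x + acos n x * esin x.
  rewrite -sc -cs -bexpD; [|by apply: bmM; [exact: (bmS _ bs)|exact: (bmY _ bc)]
                        |by apply: bmM; [exact: (bmS _ bc)|exact: (bmY _ bs)]].
  by apply: eq_Rintegral => t _; rewrite /partial_sum big_ord_recr/= mulrDr sinD.
rewrite [RHS]exprS -IH /sqr_charfun; ring.
Qed.

(** [|phi|^2] is the characteristic function of [Y 0 - Y 1], whose law is symmetric. *)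
Lemma sqr_charfun_diff x :
  1 - sqr_charfun x = \int[Q]_t (1 - cos (x * (Y 0%N t - Y 1%N t))).
Proof.
have bc := bm_cosM x; have bs := bm_sinM x.
have S1 : partial_sum Y 1 = Y 0%N by apply/funext => t; rewrite /partial_sum big_ord1.
have := bexp_partial_sum_indep indY 1%N bc bc.
have := bexp_partial_sum_indep indY 1%N bs bs.
rewrite S1 !(bexp_law (YX _) bc) !(bexp_law (YX _) bs) -!expr2 => ss cc.
rewrite bexpB; [|exact: bm_cst|].
  rewrite bexp_cst /sqr_charfun; congr (_ - _).
  rewrite -/(ecos x) -/(esin x) in ss cc *.
  rewrite -cc -ss -bexpD; [|by apply: bmM; [exact: (bmY _ bc)|exact: (bmY _ bc)]
                        |by apply: bmM; [exact: (bmY _ bs)|exact: (bmY _ bs)]].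
  by apply: eq_Rintegral => t _; rewrite mulrBr cosB.
apply: (bm_compRV bc); apply: measurable_funB; exact: measurable_funP.
Qed.

(** Pointwise, [4 * (1 - cos z) - (1 - cos (2 * z)) = 2 * (1 - cos z) ^+ 2]. *)
Lemma sqr_charfun_double x :
  1 - sqr_charfun (2 * x) <= 4 * (1 - sqr_charfun x).
Proof.
have bcos (y : R) : bounded_measurable (fun t => 1 - cos (y * (Y 0%N t - Y 1%N t))).
  apply: bmB; first exact: bm_cst.
  apply: (bm_compRV (bm_cosM y)); apply: measurable_funB; exact: measurable_funP.
rewrite !sqr_charfun_diff -bexpZ//; apply: bexp_le => //.
  by apply: bmM => //; exact: bm_cst.
move=> t; rewrite -mulrA [2 * _]mulrC mulr_natr cos_mulr2n.
set z := cos _; have := sqr_ge0 (z - 1); rewrite mulr2n => H; nra.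
Qed.

Lemma sqr_charfun_double_iter k x :
  1 - sqr_charfun (2 ^+ k * x) <= 4 ^+ k * (1 - sqr_charfun x).
Proof.
elim: k => [|k IH]; first by rewrite !expr0 !mul1r.
rewrite !exprS -!mulrA (le_trans (sqr_charfun_double _))//.
by rewrite ler_wpM2l.
Qed.

Lemma sqr_charfun_ge0 x : 0 <= sqr_charfun x.
Proof. by rewrite addr_ge0// sqr_ge0. Qed.

Lemma sqr_charfun_le1 x : sqr_charfun x <= 1.
Proof.
rewrite -subr_ge0 sqr_charfun_diff; apply: Rintegral_ge0 => t _.
by rewrite subr_ge0 (le_trans (ler_norm _))// cos_max.
Qed.

(* Pair the two expectations with the unit vector in the direction of
   [(ecos (c * x), esin (c * x))] and use Cauchy-Schwarz. *)
Lemma charfun_random_sum dN (TN : measurableType dN) (P : probability TN R)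
    (N : {RV P >-> nat}) (M : {RV Q >-> nat}) (c x : R) :
  eq_law M N -> independent_of_family M Y ->
  eq_law (random_sum M Y : {RV Q >-> R})
    (c *: (X : {mfun TX >-> R}) : {RV PX >-> R}) ->
  Num.sqrt (sqr_charfun (c * x)) <= pgf N (Num.sqrt (sqr_charfun x)).
Proof.
move=> MN indM SX.
have bc := bm_cosM x; have bs := bm_sinM x.
have Ec : ecos (c * x) = \int[P]_t acos (N t) x.
  rewrite -(bexp_random_sum MN indM bc) (bexp_law SX bc).
  by apply: eq_Rintegral => t _; rewrite mulrCA mulrA.
have Es : esin (c * x) = \int[P]_t asin (N t) x.
  rewrite -(bexp_random_sum MN indM bs) (bexp_law SX bs).
  by apply: eq_Rintegral => t _; rewrite mulrCA mulrA.
set rho := Num.sqrt (sqr_charfun x).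
have rho01 : 0 <= rho <= 1.
  by rewrite sqrtr_ge0 -[X in _ <= X]sqrtr1 ler_wsqrtr// sqr_charfun_le1.
have E1 n (h : R -> R) : (forall y, `|h y| <= 1) -> bounded_measurable h ->
    `|\int[Q]_t h (partial_sum Y n t)| <= 1.
  move=> h1 bh; rewrite (le_trans (le_normr_Rintegral _ _))//.
    exact/bm_integrable/bmS.
  rewrite -[leRHS](bexp_cst Q); apply: bexp_le => //; last exact: bm_cst.
  exact/bm_norm/bmS.
have bac : bounded_measurable (fun t => acos (N t) x).
  by apply: (@bm_comp_nat _ _ _ P N (fun n => acos n x) 1) => n; apply: E1 bc => y; exact: cos_max.
have bas : bounded_measurable (fun t => asin (N t) x).
  by apply: (@bm_comp_nat _ _ _ P N (fun n => asin n x) 1) => n; apply: E1 bs => y; exact: sin_max.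
set A := ecos (c * x); set B := esin (c * x).
set z := Num.sqrt _; have z0 : 0 <= z by exact: sqrtr_ge0.
have z2 : z ^+ 2 = A ^+ 2 + B ^+ 2 by rewrite sqr_sqrtr// sqr_charfun_ge0.
have brho := bm_pgf N rho01.
have : z ^+ 2 <= z * pgf N rho.
  rewrite z2 !expr2 {2}/A {2}/B Ec Es -!bexpZ// -bexpD//; last 2 first.
  - by apply: bmM => //; exact: bm_cst.
  - by apply: bmM => //; exact: bm_cst.
  apply: bexp_le.
  - by apply: bmD; apply: bmM => //; exact: bm_cst.
  - by apply: bmM; [exact: bm_cst|exact: bm_pgf].
  move=> t; have := sqr_charfun_sum (N t) x; rewrite -/(acos _ x) -/(asin _ x).
  rewrite -(sqr_sqrtr (sqr_charfun_ge0 x)) -/rho exprAC.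
  set a := acos _ _; set b := asin _ _; set w := rho ^+ _ => abw.
  have w0 : 0 <= w by rewrite exprn_ge0//; case/andP: rho01.
  rewrite (le_trans (ler_norm _))// -(@ler_pXn2r _ 2)// ?nnegrE ?mulr_ge0//.
  rewrite -normrX ger0_norm ?sqr_ge0// exprMn z2 -abw.
  rewrite -subr_ge0 (_ : _ - _ = (A * b - B * a) ^+ 2) ?sqr_ge0//; ring.
have [->|z_neq0] := eqVneq z 0.
  by move=> _; apply: pgf_ge0; case/andP: rho01.
by rewrite expr2 ler_pM2l// lt_neqAle eq_sym z_neq0.
Qed.

End characteristic_function.

(** * Bounds on [E[N]] forced by stability *)

Section stable_necessary.
Context d (T : measurableType d) (R : realType) (Q : probability T R).
Variables (Y : nat -> {RV Q >-> R}) (M : {RV Q >-> nat}).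
Hypothesis indY : mutually_independent Y.
Context dX (TX : measurableType dX) (PX : probability TX R) (X : {RV PX >-> R}).
Hypothesis YX : forall i, eq_law (Y i) X.
Context dN (TN : measurableType dN) (P : probability TN R) (N : {RV P >-> nat}).
Hypotheses (MN : eq_law M N) (indM : independent_of_family M Y).
Variable c : R.
Hypotheses (c0 : 0 < c) (SX : eq_law (random_sum M Y : {RV Q >-> R})
  (c *: (X : {mfun TX >-> R}) : {RV PX >-> R})).
Hypothesis X_neq0 : ~ {ae PX, forall t, X t = 0}.

Let mX : measurable_fun setT X. Proof. exact: measurable_funP. Qed.

Let mY i : measurable_fun setT (Y i). Proof. exact: measurable_funP. Qed.

Let bm1 (A : set R) : measurable A -> bounded_measurable (\1_A : R -> R).
Proof. exact: bm_indic. Qed.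

(* [P(X = 0) = P(S_N = 0) >= f(P(X = 0))], while [f(p) > p] on [[0, 1)] when
   [E[N] <= 1] and [N] is not almost surely [1]. *)
Lemma stable_expectation_gt1 : ~ {ae P, forall t, N t = 1%N} ->
  (1 < 'E_P[fun t => (N t)%:R : R])%E.
Proof.
move=> N1; rewrite ltNge; apply/negP => EN; apply: N1.
have b0 := bm1 (measurable_set1 (0 : R)).
set p : R := \int[PX]_t \1_[set 0] (X t).
have p0 : 0 <= p by apply: Rintegral_ge0 => t _; rewrite indicE.
have p_neq1 : p != 1.
  apply/eqP => /bexp_indic1_ae H; apply: X_neq0.
  by have := H mX (measurable_set1 _).
have p1 : p <= 1.
  rewrite -[leRHS](bexp_cst PX); apply: bexp_le.
  - exact: bm_compRV b0 mX.
  - exact: bm_cst.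
  - by move=> t; rewrite indicE lern1; case: (_ \in _).
apply: (@pgf_fixed_subcritical _ _ _ P N p) => //.
  by rewrite p0 lt_neqAle p_neq1.
have EX : p = \int[Q]_t \1_[set 0] (random_sum M Y t).
  rewrite (bexp_law SX b0); apply: eq_Rintegral => t _.
  rewrite !indicE; congr (_%:R).
  apply: (congr1 nat_of_bool); apply/idP/idP => /set_mem /= H; apply/mem_set => /=.
    by transitivity (c * X t) => //; rewrite H mulr0.
  have {}H : c * X t = 0 := H.
  by move/eqP: H; rewrite mulf_eq0 gt_eqF//= => /eqP.
rewrite [leRHS]EX (bexp_random_sum MN indM b0); apply: bexp_le.
- by apply: bm_pgf; rewrite p0.
- apply: (@bm_comp_nat _ _ _ P N (fun n => \int[Q]_w \1_[set 0] (partial_sum Y n w)) 1) => n.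
  rewrite ger0_norm; last by apply: Rintegral_ge0 => t _; rewrite indicE.
  rewrite -[leRHS](bexp_cst Q); apply: bexp_le; last 1 first.
  - by move=> t; rewrite indicE lern1; case: (_ \in _).
  - exact: bm_compRV b0 (measurable_partial_sum Y n).
  - exact: bm_cst.
move=> t; move: (N t) => {t} n.
have mE : measurable (\bigcap_(i < n) (Y i @^-1` [set 0])).
  by apply: bigcap_measurableType => i _; exact: measurable_preimageT.
have pE i : Q (Y i @^-1` [set 0]) = p%:E.
  rewrite /p -(bexp_law (YX i) b0).
  rewrite (_ : (fun t => \1_[set 0] (Y i t)) = \1_(Y i @^-1` [set 0])) //.
  by rewrite bexp_indic ?fineK ?fin_num_measure//; exact: measurable_preimageT.
have -> : p ^+ n = \int[Q]_w \1_(\bigcap_(i < n) (Y i @^-1` [set 0])) w.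
  rewrite bexp_indic// mutually_independent_ord//.
  by under eq_bigr do rewrite pE; rewrite prodEFin/= prodr_const card_ord.
apply: bexp_le; [exact: bm_indic|exact: bm_compRV b0 (measurable_partial_sum Y n)|].
move=> w; rewrite !indicE ler_nat.
have [/set_mem H|//] := boolP (w \in \bigcap_(i < n) (Y i @^-1` [set 0])).
rewrite mem_set//= /partial_sum big1// => i _; exact: (H i (ltn_ord i)).
Qed.

Let v x := 1 - sqr_charfun X x.

(** The infinite slope of [f] at [1] makes [v (c * x)] much larger than [v x], whereas the doubling
    inequality bounds [v (c * x)] by a multiple of [v] at a point [lam * x] nearer to [0]. Together,
    [v] at least doubles when the argument shrinks by [lam]. *)
Let v_halved : ('E_P[fun t => (N t)%:R : R] = +oo)%E ->
  exists lam s0 : R, [/\ 0 < lam < 1, s0 < 1 &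
    forall x, s0 <= sqr_charfun X x -> v x <= 2^-1 * v (lam * x)].
Proof.
move=> Noo.
(* Nothing relates [c] to [1]; enough doublings bring the ratio [c / 2 ^+ k] below [1]. *)
pose k := Num.bound c.
have ck : c < 2 ^+ k.
  rewrite (@lt_trans _ _ k%:R)//.
    by have := archi_boundP (ltW c0).
  by rewrite -natrX ltr_nat ltn_expl.
have k0 : 0 < (2 : R) ^+ k by rewrite exprn_gt0.
have k40 : 0 < (4 : R) ^+ k by rewrite exprn_gt0.
(* The factor [4 ^+ k] pays for the [k] doublings; the other [4] pays for
   [1 - rho ^+ 2 <= 2 * (1 - rho)] and for the gain of [2]. *)
have [] := @pgf_slope _ _ _ P N (4 * 4 ^+ k); first by rewrite Noo ltry.
move=> s0 /andP[s00 s01] H; exists (c / 2 ^+ k), s0; split=> //.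
  by rewrite divr_gt0// ltr_pdivrMr// mul1r.
move=> x sx; set rho := Num.sqrt (sqr_charfun X x).
have r1 := sqr_charfun_le1 indY YX x.
have rho2 : rho ^+ 2 = sqr_charfun X x by rewrite sqr_sqrtr// sqr_charfun_ge0.
have rho0 : 0 <= rho by exact: sqrtr_ge0.
have rho1 : rho <= 1 by rewrite -sqrtr1 ler_wsqrtr.
have rhos : s0 <= rho by rewrite (le_trans sx)// -rho2 expr2 ler_piMr.
have Hr := H rho; rewrite rhos rho1 in Hr; have {}Hr := Hr isT.
have cf := charfun_random_sum indY YX x MN indM SX; rewrite -/rho in cf.
have rc1 := sqr_charfun_le1 indY YX (c * x).
have rcE : Num.sqrt (sqr_charfun X (c * x)) ^+ 2 = sqr_charfun X (c * x).
  by rewrite sqr_sqrtr// sqr_charfun_ge0.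
have rc0 : 0 <= Num.sqrt (sqr_charfun X (c * x)) by exact: sqrtr_ge0.
have rc1' : Num.sqrt (sqr_charfun X (c * x)) <= 1 by rewrite -sqrtr1 ler_wsqrtr.
have vc : 1 - Num.sqrt (sqr_charfun X (c * x)) <= v (c * x).
  by rewrite /v lerD2l lerN2 -[X in X <= _]rcE expr2 ler_piMr.
have vk : v (c * x) <= 4 ^+ k * v (c / 2 ^+ k * x).
  have := sqr_charfun_double_iter indY YX k (c / 2 ^+ k * x).
  by rewrite mulrA [_ * (c / _)]mulrC divfK ?gt_eqF.
have v2 : v x <= 2 * (1 - rho).
  by rewrite /v -rho2; have := sqr_ge0 (1 - rho); lra.
rewrite -(ler_pM2l k40).
set w := v (c / _ * x) in vk *.
have : 4 * 4 ^+ k * (1 - rho) <= 4 ^+ k * w by lra.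
set K := 4 ^+ k in k40 *; nra.
Qed.

Let v_cvg0 lam : 0 < lam < 1 -> v (lam ^+ n) @[n --> \oo] --> (0 : R).
Proof.
move=> /andP[l0 l1].
rewrite (_ : (fun n => _) = (fun n => \int[Q]_t (1 - cos (lam ^+ n * (Y 0%N t - Y 1%N t))))); last first.
  by apply/funext => n; rewrite /v (sqr_charfun_diff indY YX).
rewrite -[X in _ --> X](bexp_cst Q).
apply: (@bexp_cvg _ _ _ _ _ _ 2) => //.
- move=> n; have [] // : bounded_measurable (fun t => 1 - cos (lam ^+ n * (Y 0%N t - Y 1%N t))).
  apply: bmB; first exact: bm_cst.
  by apply: (bm_compRV (bm_cosM _)); exact: measurable_funB.
- move=> n t; rewrite (le_trans (ler_normB _ _))// normr1.
  by have := cos_max (lam ^+ n * (Y 0%N t - Y 1%N t)); lra.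
apply: aeW => t.
have -> : 0 = 1 - cos (0 * (Y 0%N t - Y 1%N t)) :> R by rewrite mul0r cos0 subrr.
apply: cvgB; first exact: cvg_cst.
apply: continuous_cvg; first exact: continuous_cos.
apply: cvgMl; apply: cvg_expr; by rewrite gtr0_norm.
Qed.

(** Since [v (lam ^+ n)] tends to [0], [v_halved] applies from some rank on; iterated, it gives [v
    (lam ^+ n) <= 2^-1 ^+ j * v (lam ^+ (n + j)) <= 2^-1 ^+ j] for all [j]. *)
Let v_eq0 : ('E_P[fun t => (N t)%:R : R] = +oo)%E ->
  exists lam n0, 0 < lam < 1 /\ forall n, (n0 <= n)%N -> v (lam ^+ n) = 0.
Proof.
move=> /v_halved[lam [s0 [l01 s01 H]]].
have [n0 _ Hn0] : \forall n \near \oo, v (lam ^+ n) < 1 - s0.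
  by apply: (cvgr_lt 0 (v_cvg0 l01)); rewrite subr_gt0.
exists lam, n0; split=> // n n0n.
have vn m : (n0 <= m)%N -> v (lam ^+ m) <= 2^-1 * v (lam ^+ m.+1).
  move=> n0m; rewrite exprS; apply: H.
  by have := Hn0 m n0m; rewrite /v; lra.
have vj j : v (lam ^+ n) <= (2^-1) ^+ j * v (lam ^+ (n + j)).
  elim: j => [|j IH]; first by rewrite addn0 mul1r.
  rewrite (le_trans IH)// exprSr -mulrA ler_wpM2l// addnS vn//.
  by rewrite (leq_trans n0n)// leq_addr.
apply/eqP; rewrite eq_le subr_ge0 (sqr_charfun_le1 indY YX) andbT.
have c0' : (2^-1 : R) ^+ j @[j --> \oo] --> (0 : R).
  by apply: cvg_expr; rewrite gtr0_norm// invf_lt1// ltr1n.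
apply: (@ler_cvg_to _ _ _ _ _ _ _ _ (@cvg_cst _ _ _ _ _) c0').
apply: nearW => j; rewrite (le_trans (vj j))// ler_piMr//.
by rewrite /v lerBlDr lerDl sqr_charfun_ge0.
Qed.

(** A vanishing [v (lam ^+ n)] puts [lam ^+ n * (Y 0 - Y 1)] in the zeros of [1 - cos] almost
    surely; for [n] large this number has absolute value below [pi], so it is [0]. *)
Let Y01 : ('E_P[fun t => (N t)%:R : R] = +oo)%E ->
  {ae Q, forall t, Y 0%N t = Y 1%N t}.
Proof.
move=> /v_eq0[lam [n0 [/andP[l0 l1] H]]].
have : {ae Q, forall t n, 1 - cos (lam ^+ (n0 + n) * (Y 0%N t - Y 1%N t)) = 0}.
  apply/ae_foralln => n; apply: bexp_eq0_ae.
  - apply: bmB; first exact: bm_cst.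
    by apply: (bm_compRV (bm_cosM _)); exact: measurable_funB.
  - by move=> t; rewrite subr_ge0 (le_trans (ler_norm _))// cos_max.
  - by rewrite -(sqr_charfun_diff indY YX); exact: H (leq_addr _ _).
apply: filterS => t Ht; set D := Y 0%N t - Y 1%N t in Ht.
have cD : lam ^+ (n0 + n) * D @[n --> \oo] --> (0 : R).
  rewrite -[X in _ --> X](mul0r D); apply: cvgMl.
  rewrite -[X in _ --> X](mulr0 (lam ^+ n0)).
  under eq_fun do rewrite exprD.
  by apply: cvgMr; apply: cvg_expr; rewrite gtr0_norm.
have [n _ /(_ n (leqnn n)) /= nD] : \forall n \near \oo, `|lam ^+ (n0 + n) * D| < pi.
  apply: (cvgr_lt 0); last exact: pi_gt0.
  by rewrite -[X in _ --> X](@normr0 _ R); exact: cvg_norm.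
have /eqP := Ht n; rewrite subr_eq0 => /eqP cosn.
have /eqP : `|lam ^+ (n0 + n) * D| = 0.
  apply: cos_inj.
  - by rewrite in_itv/= normr_ge0 ltW.
  - by rewrite in_itv/= lexx pi_ge0.
  - by rewrite cos_norm -cosn cos0.
by rewrite normr_eq0 mulf_eq0 expf_eq0 (gt_eqF l0) andbF/= subr_eq0 => /eqP.
Qed.

Lemma stable_expectation_lty : ('E_P[fun t => (N t)%:R : R] < +oo)%E.
Proof.
rewrite ltey; apply/eqP => Noo; have Y01E := Y01 Noo.
(* [X] may have no moments. A bounded injective image of it has a variance, and constancy can be
   read off that image. *)
have matan : measurable_fun setT (@atan R).
  exact: continuous_measurable_fun (@continuous_atan R).
have ba : bounded_measurable (@atan R).
  apply: (@bm_bound _ _ _ _ (pi / 2)) => // x.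
  by rewrite ler_norml !ltW ?atan_gtNpi2 ?atan_ltpi2.
have ba2 : bounded_measurable (fun x : R => atan x ^+ 2) by exact: bmX.
set e := \int[PX]_t atan (X t).
have Ee i : \int[Q]_t atan (Y i t) = e by rewrite (bexp_law (YX i) ba).
have S1 : partial_sum Y 1 = Y 0%N by apply/funext => t; rewrite /partial_sum big_ord1.
(* The copies [Y 0] and [Y 1] are independent and almost surely equal, so the mean of the square is
   the square of the mean. *)
have E2 : \int[PX]_t (atan (X t) ^+ 2) = e ^+ 2.
  rewrite -(bexp_law (YX 0%N) ba2) expr2 -{1}(Ee 0%N) -(Ee 1%N) -S1.
  rewrite -(bexp_partial_sum_indep indY 1%N ba ba) S1; apply: bexp_ae.
  - exact: bm_compRV ba2 (mY 0%N).
  - by apply: bmM; apply: bm_compRV ba _.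
  - by apply: filterS Y01E => t <-; rewrite expr2.
have baX : bounded_measurable (fun t => atan (X t)) by exact: bm_compRV ba mX.
have Xe : {ae PX, forall t, (atan (X t) - e) ^+ 2 = 0}.
  apply: bexp_eq0_ae.
  - by apply: bmX; apply: bmB => //; exact: bm_cst.
  - by move=> t; exact: sqr_ge0.
  - have -> : (fun t => (atan (X t) - e) ^+ 2) =
      (fun t => atan (X t) ^+ 2 - 2 * e * atan (X t) + e ^+ 2).
      by apply/funext => t; ring.
    rewrite bexpD; [|by apply: bmB; [exact: bmX|apply: bmM => //; exact: bm_cst]|exact: bm_cst].
    rewrite bexpB; [|exact: bmX|by apply: bmM => //; exact: bm_cst].
    rewrite bexpZ// E2 (bexp_cst PX (e ^+ 2)) -/e; ring.
pose x0 := tan e.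
have {}Xe : {ae PX, forall t, [set x0] (X t)}.
  apply: filterS Xe => t /eqP; rewrite sqrf_eq0 subr_eq0 => /eqP Xt.
  by rewrite /x0 -Xt /= atanK.
have x0_neq0 : x0 != 0.
  by apply/eqP => x00; apply: X_neq0; apply: filterS Xe => t ->.
have Yx0 : {ae Q, forall t i, Y i t = x0}.
  apply/ae_foralln => i; apply/(@bexp_indic1_ae _ _ _ _ _ Q (Y i) [set x0]) => //.
  by rewrite (bexp_law (YX i) (bm1 (measurable_set1 x0))); apply/(@bexp_indic1_ae _ _ _ _ _ PX X [set x0]).
have bcx := bm1 (measurable_set1 (c * x0)).
(* The random sum is almost surely [c * x0], while the partial sum of [n] terms is almost surely
   [n * x0]; as [x0 != 0], this says that [N = c] with probability [1]. *)
have Ncx : \int[P]_t (fun n => \int[Q]_w \1_[set c * x0] (partial_sum Y n w)) (N t) = 1.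
  rewrite -(bexp_random_sum MN indM bcx) (bexp_law SX bcx).
  apply/(@bexp_indic1_ae _ _ _ _ _ PX (fun t => c * X t) [set c * x0]) => //.
    exact: measurable_funM.
  by apply: filterS Xe => t /= ->.
have Nc : {ae P, forall t, [set n | n%:R = c] (N t)}.
  apply/(@bexp_indic1_ae _ _ _ _ _ P N) => //; rewrite -[RHS]Ncx.
  apply: eq_Rintegral => t _; move: (N t) => {t} n.
  rewrite -[LHS](bexp_cst Q); apply: bexp_ae.
  - exact: bm_cst.
  - exact: bm_compRV bcx (measurable_partial_sum Y n).
  apply: filterS Yx0 => w Yw; rewrite !indicE; congr (_%:R).
  have -> : partial_sum Y n w = n%:R * x0.
    by rewrite /partial_sum (eq_bigr (fun=> x0))// sumr_const card_ord mulr_natl.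
  apply: (congr1 nat_of_bool); apply/idP/idP => /set_mem /= H; apply/mem_set => /=.
    by rewrite H.
  exact: (mulIf x0_neq0) H.
have : (\int[P]_t ((N t)%:R : R)%:E = c%:E)%E.
  transitivity (\int[P]_t c%:E)%E; last by rewrite integral_cst// [X in (_ * X)%E]probability_setT mule1.
  apply: ae_eq_integral => //.
    exact/measurable_EFinP/(@measurable_comp_nat _ _ _ P N (fun n => n%:R)).
  by apply: filterS Nc => t /= -> _.
by move: Noo; rewrite unlock => ->.
Qed.

End stable_necessary.

(** * Coin tossing *)

Definition coin_box (n : nat) (S : nat -> set bool) : set (nat -> bool) :=
  [set w | forall i, (i < n)%N -> S i (w i)].

(** The cylinders: a pi-system generating the product sigma-algebra on bit sequences. *)
Definition coin_boxes : set (set (nat -> bool)) :=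
  [set A | exists n S, A = coin_box n S].

Notation coins := (g_sigma_algebraType coin_boxes).

(** Brings two boxes to a common length. *)
Lemma coin_box_pad n k S : (n <= k)%N ->
  coin_box n S = coin_box k (fun i => if (i < n)%N then S i else setT).
Proof.
move=> nk; apply/seteqP; split => w H i ilt.
  by case: ifPn => // /H.
by have := H i (leq_trans ilt nk); rewrite ilt.
Qed.

Lemma coin_boxesI : setI_closed coin_boxes.
Proof.
move=> _ _ [n [S ->]] [m [S' ->]].
exists (maxn n m), (fun i => (if (i < n)%N then S i else setT) `&`
  (if (i < m)%N then S' i else setT)).
rewrite (coin_box_pad S (leq_maxl n m)) (coin_box_pad S' (leq_maxr n m)).
apply/seteqP; split => w.
  by move=> [H1 H2] i ilt; split; [exact: H1|exact: H2].
by move=> H; split => i /H[].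
Qed.

Lemma coin_boxesT : coin_boxes setT.
Proof. by exists 0%N, (fun=> setT); apply/seteqP; split. Qed.

Lemma measurable_to_coins d (T : measurableType d) (f : T -> coins) :
  (forall n S, measurable (f @^-1` coin_box n S)) -> measurable_fun setT f.
Proof.
move=> mf; apply: (@measurability _ _ T coins setT f coin_boxes) => //.
by move=> _ [_ [n [S ->]] <-]; rewrite setTI; exact: mf.
Qed.

Definition evens (w : coins) : coins := fun k => w k.*2.
Definition odds (w : coins) : coins := fun k => w k.*2.+1.

Lemma measurable_coin_box n S : measurable (coin_box n S : set coins).
Proof. by apply: sub_gen_smallest; exists n, S. Qed.

(** Interleaving the sides turns a pair of boxes into one box of double length. Measurability and
    independence of the two halves both rest on this. *)
Lemma evens_odds_box n S S' :
  evens @^-1` coin_box n S `&` odds @^-1` coin_box n S' =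
  coin_box n.*2 (fun i => if odd i then S' i./2 else S i./2).
Proof.
apply/seteqP; split => w.
  move=> [H1 H2] i ilt; have := odd_double_half i.
  have i2 : (i./2 < n)%N by rewrite ltn_half_double.
  case: (odd i) => /= <-; first by rewrite /= uphalf_double; exact: H2.
  by rewrite add0n doubleK; exact: H1.
move=> H; split=> i ilt.
  have := H i.*2; rewrite odd_double doubleK; apply.
  by rewrite ltn_double.
have := H i.*2.+1; rewrite /= odd_double /= uphalf_double; apply.
by rewrite ltn_Sdouble.
Qed.

Lemma evens_box n S : evens @^-1` coin_box n S =
  coin_box n.*2 (fun i => if odd i then setT else S i./2).
Proof.
rewrite -(evens_odds_box n S (fun=> setT)); apply/seteqP; split => w; last by case.
by move=> H; split.
Qed.

Lemma odds_box n S : odds @^-1` coin_box n S =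
  coin_box n.*2 (fun i => if odd i then S i./2 else setT).
Proof.
rewrite -(evens_odds_box n (fun=> setT) S); apply/seteqP; split => w; last by case.
by move=> H; split.
Qed.

Lemma measurable_evens : measurable_fun setT evens.
Proof. by apply: measurable_to_coins => n S; rewrite evens_box; exact: measurable_coin_box. Qed.

Lemma measurable_odds : measurable_fun setT odds.
Proof. by apply: measurable_to_coins => n S; rewrite odds_box; exact: measurable_coin_box. Qed.

(** * Fair coin tosses as the binary digits of a uniform point *)

Section binary_digits.
Context (R : realType).

Definition top_bit (t : R) : bool := 2^-1 <= t.
(** On [[0, 1[] this is [2 * t] modulo [1], the shift of the binary expansion. *)
Definition doubling (t : R) : R := 2 * t - (top_bit t)%:R.
Definition digits (t : R) : coins := fun k => top_bit (iter k doubling t).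

Lemma measurable_top_bit : measurable_fun setT top_bit.
Proof. by apply: measurable_fun_ler => //; exact: measurable_cst. Qed.

Lemma measurable_doubling : measurable_fun setT doubling.
Proof.
apply: measurable_funB.
  by apply: measurable_funM => //; exact: measurable_cst.
apply: (@measurableT_comp _ _ _ _ _ _ (fun b : bool => b%:R : R)) => //.
exact: measurable_top_bit.
Qed.

Lemma measurable_digit k : measurable_fun setT (fun t => digits t k).
Proof.
apply: (@measurableT_comp _ _ _ _ _ _ top_bit); first exact: measurable_top_bit.
elim: k => [|k IH]; first exact: measurable_id.
exact: (measurableT_comp measurable_doubling IH).
Qed.

Lemma measurable_digits : measurable_fun setT digits.
Proof.
apply: measurable_to_coins => n S.
rewrite (_ : _ @^-1` _ = \bigcap_(i < n) ((fun t => digits t i) @^-1` S i)).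
  apply: bigcap_measurableType => i _.
  by apply: measurable_preimageT => //; exact: measurable_digit.
by apply/seteqP; split.
Qed.

Lemma doubling_itv t : 0 <= t < 1 -> 0 <= doubling t < 1.
Proof.
move=> /andP[t0 t1]; rewrite /doubling /top_bit.
by case: (lerP 2^-1 t) => h /=; apply/andP; split; lra.
Qed.

Lemma iter_doubling_itv n t : 0 <= t < 1 -> 0 <= iter n doubling t < 1.
Proof. by move=> t01; elim: n => //= n; exact: doubling_itv. Qed.

Lemma digits_sum n t :
  t = \sum_(k < n) (digits t k)%:R * 2^-1 ^+ k.+1 + 2^-1 ^+ n * iter n doubling t.
Proof.
elim: n => [|n IH]; first by rewrite big_ord0 add0r mul1r.
rewrite big_ord_recr/= {1}IH -addrA; congr (_ + _).
rewrite /digits; set z := iter n doubling t.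
by rewrite exprSr /doubling -/z; field.
Qed.

(** The mass of [S] for a fair coin. *)
Definition half_count (S : set bool) : R := (\1_S false + \1_S true) / 2.

Local Notation leb := (@lebesgue_measure R).

(** The induction needs all dyadic intervals: on one of length [2^-1 ^+ j] the first [j] digits are
    fixed and [iter j doubling] is affine. The next digit tells its left half from its right half,
    and the induction hypothesis applies to each half with the box shifted by one coordinate. *)
Let digits_box_aux n : forall j (x : R) (S : nat -> set bool),
  (forall t : R, x <= t < x + 2^-1 ^+ j -> iter j doubling t = 2 ^+ j * (t - x)) ->
  leb (`[x, x + 2^-1 ^+ j[%classic `&`
    [set t | forall i, (i < n)%N -> S i (digits t (j + i)%N)]) =
  (2^-1 ^+ j * \prod_(i < n) half_count (S i))%:E.
Proof.
elim: n => [|n IH] j x S xj.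
  rewrite big_ord0 mulr1.
  rewrite (_ : [set t | forall i, (i < 0)%N -> S i (digits t (j + i)%N)] = setT);
    last by apply/seteqP; split => // t _ i.
  rewrite setIT lebesgue_measure_itv/= lte_fin ltrDl exprn_gt0// -EFinD.
  by rewrite addrAC subrr add0r.
have j0 : 0 < (2^-1 : R) ^+ j by rewrite exprn_gt0.
have j2 : (2 : R) ^+ j * 2^-1 ^+ j = 1 by rewrite -exprMn divff// expr1n.
pose y := x + 2^-1 ^+ j.+1.
have jS : (2^-1 : R) ^+ j.+1 = 2^-1 * 2^-1 ^+ j by rewrite exprS.
have xy : x + 2^-1 ^+ j = y + 2^-1 ^+ j.+1 by rewrite /y jS; field.
pose E (z : R) := `[z, z + 2^-1 ^+ j.+1[%classic `&`
    [set t | forall i, (i < n)%N -> S i.+1 (digits t (j.+1 + i)%N)].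
have mE z : measurable (E z).
  apply: measurableI; first exact: measurable_itv.
  rewrite (_ : [set t | _] = \bigcap_(i < n) ((fun t => digits t (j.+1 + i)%N) @^-1` S i.+1)).
    apply: bigcap_measurableType => i _.
    by apply: measurable_preimageT => //; exact: measurable_digit.
  by apply/seteqP; split.
have xt t : x <= t < y -> iter j doubling t = 2 ^+ j * (t - x) /\ digits t j = false.
  move=> /andP[h1 h2]; have H := xj t; rewrite h1 xy in H.
  have H1 : iter j doubling t = 2 ^+ j * (t - x).
    by apply: H; rewrite /= (lt_trans h2)// ltrDl exprn_gt0.
  split=> //; rewrite /digits H1 /top_bit; apply/negbTE; rewrite -ltNge.
  rewrite -(ltr_pM2l j0) mulrA [_ * 2 ^+ _]mulrC j2 mul1r mulrC -jS.
  by rewrite ltrBlDl.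
have yt t : y <= t < y + 2^-1 ^+ j.+1 ->
    iter j doubling t = 2 ^+ j * (t - x) /\ digits t j = true.
  move=> /andP[h1 h2]; have H := xj t; rewrite xy h2 andbT in H.
  have H1 : iter j doubling t = 2 ^+ j * (t - x).
    by apply: H; rewrite (le_trans _ h1)// lerDl exprn_ge0.
  split=> //; rewrite /digits H1 /top_bit.
  rewrite -(ler_pM2l j0) mulrA [_ * 2 ^+ _]mulrC j2 mul1r mulrC -jS.
  by rewrite lerBrDl.
have Ex : leb (E x) = (2^-1 ^+ j.+1 * \prod_(i < n) half_count (S i.+1))%:E.
  apply: (IH j.+1 x (fun i => S i.+1)) => t t1.
  have [H1 H2] := xt t t1; rewrite /= {1}/doubling -[top_bit _]/(digits t j) H2 H1.
  by rewrite subr0 exprS mulrA.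
have Ey : leb (E y) = (2^-1 ^+ j.+1 * \prod_(i < n) half_count (S i.+1))%:E.
  apply: (IH j.+1 y (fun i => S i.+1)) => t t1.
  have [H1 H2] := yt t t1; rewrite /= {1}/doubling -[top_bit _]/(digits t j) H2 H1.
  by rewrite /y exprS jS -mulrA -[X in _ - X]j2 /=; field.
have -> : `[x, x + 2^-1 ^+ j[%classic `&`
    [set t | forall i, (i < n.+1)%N -> S i (digits t (j + i)%N)] =
  (if false \in S 0%N then E x else set0) `|` (if true \in S 0%N then E y else set0).
  apply/seteqP; split => t /=.
    rewrite in_itv/= => -[/andP[h1 h2] H].
    have H0 := H 0%N isT; rewrite addn0 in H0.
    have HS i : (i < n)%N -> S i.+1 (digits t (j.+1 + i)%N).
      by move=> ilt; rewrite addSnnS; exact: (H i.+1 ilt).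
    have [ty|yt'] := ltP t y.
      left; have [|_ dj] := xt t; first by rewrite h1 ty.
      by rewrite dj in H0; rewrite mem_set//; split => //=; rewrite in_itv/= h1 ty.
    right; have h2' : t < y + 2^-1 ^+ j.+1 by rewrite -xy.
    have [|_ dj] := yt t; first by rewrite yt' h2'.
    by rewrite dj in H0; rewrite mem_set//; split => //=; rewrite in_itv/= yt' h2'.
  case.
    case: ifPn => // /set_mem S0 [/=]; rewrite in_itv/= => /andP[h1 h2] H.
    split; first by rewrite in_itv/= h1 xy (lt_trans h2)// ltrDl exprn_gt0.
    move=> [_|i ilt]; last by rewrite -addSnnS; exact: H.
    by rewrite addn0 (xt t _).2// h1.
  case: ifPn => // /set_mem S0 [/=]; rewrite in_itv/= => /andP[h1 h2] H.
  split; first by rewrite in_itv/= xy h2 (le_trans _ h1)// lerDl exprn_ge0.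
  move=> [_|i ilt]; last by rewrite -addSnnS; exact: H.
  by rewrite addn0 (yt t _).2// h1.
have XE (b : bool) z : leb (if b then E z else set0) = (b%:R%:E * leb (E z))%E.
  by case: b; rewrite ?mul1e// mul0e measure0.
transitivity (leb (if false \in S 0%N then E x else set0) +
    leb (if true \in S 0%N then E y else set0))%E; first apply: measureU.
- by case: ifP => _; [exact: mE|exact: measurable0].
- by case: ifP => _; [exact: mE|exact: measurable0].
- case: ifP => _; last by rewrite set0I.
  case: ifP => _; last by rewrite setI0.
  apply/seteqP; split => // t [[/=]]; rewrite !in_itv/= => /andP[_ h] _ [/andP[h' _] _].
  by have := lt_le_trans h h'; rewrite /y ltxx.
rewrite !XE Ex Ey big_ord_recl/= -!EFinM -EFinD; congr (_%:E).
by rewrite /half_count !indicE exprS; field.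
Qed.

Lemma lebesgue_digits_box n S :
  leb (`[0, 1[%classic `&` digits @^-1` coin_box n S) =
  (\prod_(i < n) half_count (S i))%:E.
Proof.
have := @digits_box_aux n 0%N 0 S; rewrite expr0 add0r mul1r => <- //.
by move=> t _; rewrite expr0 mul1r subr0.
Qed.

Lemma measurable_itv01 : measurable (`[0, 1[%classic : set R).
Proof. exact: measurable_itv. Qed.

Definition uniform01 : set R -> \bar R := mrestr leb measurable_itv01.

Let uniform01_0 : uniform01 set0 = 0%E. Proof. exact: measure0. Qed.

Let uniform01_ge0 A : (0 <= uniform01 A)%E. Proof. exact: measure_ge0. Qed.

Let uniform01_sigma_additive : semi_sigma_additive uniform01.
Proof. exact: (@measure_semi_sigma_additive _ _ _ (mrestr leb measurable_itv01)). Qed.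

HB.instance Definition _ := isMeasure.Build _ _ _ uniform01
  uniform01_0 uniform01_ge0 uniform01_sigma_additive.

Let uniform01T : uniform01 setT = 1%E.
Proof.
by rewrite /uniform01 /mrestr setTI lebesgue_measure_itv/= lte_fin ltr01 oppr0 adde0.
Qed.

HB.instance Definition _ := Measure_isProbability.Build _ _ _ uniform01 uniform01T.

Definition digits_mfun : {mfun R >-> coins} := mfun_Sub (mem_set measurable_digits).

(** The infinite product of fair coins, obtained as an image of Lebesgue measure. *)
Definition coin_prob : probability coins R := distribution uniform01 digits_mfun.

Lemma coin_prob_box n S : coin_prob (coin_box n S) = (\prod_(i < n) half_count (S i))%:E.
Proof.
by rewrite -lebesgue_digits_box setIC.
Qed.

Lemma coin_prob_evens_odds_box n m S S' :
  coin_prob (evens @^-1` coin_box n S `&` odds @^-1` coin_box m S') =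
  (coin_prob (coin_box n S) * coin_prob (coin_box m S'))%E.
Proof.
rewrite (coin_box_pad S (leq_maxl n m)) (coin_box_pad S' (leq_maxr n m)).
rewrite evens_odds_box !coin_prob_box -EFinM; congr (_%:E).
set F := (fun i => if (i < n)%N then S i else setT).
set F' := (fun i => if (i < m)%N then S' i else setT).
elim: (maxn n m) => [|k IH]; first by rewrite !big_ord0 mulr1.
rewrite doubleS 2!big_ord_recr/= IH odd_double doubleK uphalf_double /=.
by rewrite !big_ord_recr/=; ring.
Qed.

(** The box case extends in two passes of [indep_pi_system], one for each half of the
    coordinates. *)
Lemma coin_prob_split A B : measurable A -> measurable B ->
  coin_prob (evens @^-1` A `&` odds @^-1` B) = (coin_prob A * coin_prob B)%E.
Proof.
(* A map that preserves the mass of all boxes preserves the measure, the boxes forming a generating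
   pi-system. *)
have preserve (f : coins -> coins) : measurable_fun setT f ->
    (forall n S, coin_prob (f @^-1` coin_box n S) = coin_prob (coin_box n S)) ->
    forall C, measurable C -> coin_prob (f @^-1` C) = coin_prob C.
  move=> mf fE C mC.
  apply: (@measure_unique _ R coins coin_boxes (fun=> setT) erefl coin_boxesI
    (fun=> coin_boxesT) _ (distribution coin_prob (mfun_Sub (mem_set mf))) coin_prob) => //.
  - by rewrite bigcup_const//; exists 0%N.
  - by move=> _ [n [S ->]]; exact: fE.
  - by move=> _; rewrite (le_lt_trans (probability_le1 _ _))// ltry.
have evensP C : measurable C -> coin_prob (evens @^-1` C) = coin_prob C.
  apply: preserve; first exact: measurable_evens.
  move=> n S; have := coin_prob_evens_odds_box n 0 S (fun=> setT).
  rewrite (_ : coin_box 0 _ = setT) ?preimage_setT ?setIT ?probability_setT ?mule1//.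
  by apply/seteqP; split.
have oddsP C : measurable C -> coin_prob (odds @^-1` C) = coin_prob C.
  apply: preserve; first exact: measurable_odds.
  move=> n S; have := coin_prob_evens_odds_box 0 n (fun=> setT) S.
  rewrite (_ : coin_box 0 _ = setT) ?preimage_setT ?setTI ?probability_setT ?mul1e//.
  by apply/seteqP; split.
pose G (f : coins -> coins) : set (set coins) := [set f @^-1` C | C in coin_boxes].
have Gm f : measurable_fun setT f -> G f `<=` measurable.
  move=> mf _ [C [n [S ->]] <-]; apply: measurable_preimageT => //.
  exact: measurable_coin_box.
have GI f : setI_closed (G f).
  by move=> _ _ [C GC <-] [D GD <-]; exists (C `&` D); [exact: coin_boxesI|].
have GT f : G f setT by exists setT; [exact: coin_boxesT|].
have Gs f C : measurable C -> <<s G f >> (f @^-1` C).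
  move=> mC; have mf : measurable_fun setT (f : g_sigma_algebraType (G f) -> coins).
    apply: measurable_to_coins => n S; apply: sub_gen_smallest.
    by exists (coin_box n S) => //; exists n, S.
  by have := mf measurableT C mC; rewrite setTI.
move=> mA mB; rewrite -(evensP A)// -(oddsP B)//.
apply: (@indep_pi_system _ _ _ coin_prob (G evens)) => //.
- exact: (Gm _ measurable_evens).
- exact: measurable_preimageT measurable_odds mB.
- move=> _ [C [n [S ->]] <-]; rewrite setIC muleC.
  apply: (@indep_pi_system _ _ _ coin_prob (G odds)) => //.
  + exact: (Gm _ measurable_odds).
  + by apply: measurable_preimageT measurable_evens _; exact: measurable_coin_box.
  + move=> _ [D [m [S' ->]] <-]; rewrite setIC coin_prob_evens_odds_box muleC.
    by rewrite oddsP ?evensP//; exact: measurable_coin_box.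
  + exact: Gs.
- exact: Gs.
Qed.

Definition binary_value (w : coins) : R :=
  fine (\sum_(k <oo) ((w k)%:R * 2^-1 ^+ k.+1)%:E)%E.

Lemma measurable_binary_value : measurable_fun setT binary_value.
Proof.
apply: (@measurableT_comp _ _ _ _ _ _ (@fine R)) => //.
apply: ge0_emeasurable_sum => [k w _ _|k _]; first by rewrite lee_fin mulr_ge0.
apply/measurable_EFinP; apply: measurable_funM => //.
apply: (@measurableT_comp _ _ _ _ _ _ (fun b : bool => b%:R : R)) => //.
move=> _ S mS; rewrite setTI; apply: sub_gen_smallest.
exists k.+1, (fun i => if i == k then S else setT).
apply/seteqP; split => w; last by move=> /(_ k (ltnSn k)); rewrite eqxx.
by move=> Sw i _; case: eqP => [->|].
Qed.

Lemma binary_value_digits t : 0 <= t < 1 -> binary_value (digits t) = t.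
Proof.
move=> t01; rewrite /binary_value.
suff -> : (\sum_(k <oo) ((digits t k)%:R * 2^-1 ^+ k.+1)%:E)%E = t%:E by [].
apply/cvg_lim => //.
rewrite (_ : (fun n => _) = EFin \o (fun n => t - 2^-1 ^+ n * iter n doubling t)); last first.
  apply/funext => n /=; rewrite sumEFin big_mkord; congr (_%:E).
  by rewrite {2}(digits_sum n t) addrK.
apply: cvg_EFin; first exact: nearW.
rewrite -[X in _ --> X]subr0; apply: cvgB; first exact: cvg_cst.
have c0 : (2^-1 : R) ^+ n @[n --> \oo] --> (0 : R).
  by apply: cvg_expr; rewrite gtr0_norm// invf_lt1// ltr1n.
apply: (squeeze_cvgr _ (cvg_cst 0) c0).
apply: nearW => n; have /andP[h0 h1] := iter_doubling_itv n t01.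
by rewrite mulr_ge0//= ler_piMr// ltW.
Qed.

(** [binary_value] undoes [digits] on [[0, 1[], so it carries coin tosses back to a uniform point,
    which the quantile function then turns into a copy of [N]. *)
Lemma coin_prob_binary_value (A : set R) : measurable A ->
  coin_prob (binary_value @^-1` A) = leb (`[0, 1[%classic `&` A).
Proof.
move=> mA; transitivity (leb ((digits @^-1` (binary_value @^-1` A)) `&` `[0, 1[%classic)) => //.
congr (leb _); apply/seteqP; split => t /=; rewrite in_itv/=.
  by move=> [Ht t01]; rewrite binary_value_digits in Ht.
by move=> [t01 At]; rewrite binary_value_digits.
Qed.

End binary_digits.

(* The quantile function of the law of [N]: [q u = n] for [u] in
   [[P(N < n), P(N < n.+1)[]. *)
Lemma quantile_nat d (T : measurableType d) (R : realType) (P : probability T R)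
  (N : {RV P >-> nat}) :
  exists2 q : R -> nat, measurable_fun setT q &
  forall A : set nat,
    lebesgue_measure (`[0, 1[%classic `&` q @^-1` A) = P (N @^-1` A).
Proof.
have mNA (A : set nat) : measurable (N @^-1` A).
  by apply: measurable_preimageT => //; exact: measurable_funP.
pose F n : R := fine (P (N @^-1` `I_n)).
have FE n : (F n)%:E = P (N @^-1` `I_n) by rewrite fineK// fin_num_measure.
have F0 : F 0%N = 0.
  by rewrite /F (_ : N @^-1` `I_0 = set0) ?measure0//; apply/seteqP; split.
have F1 n : F n <= 1 by rewrite -lee_fin FE probability_le1.
have FS n : (F n.+1)%:E = (P (N @^-1` [set n]) + (F n)%:E)%E.
  rewrite !FE -measureU//; last first.
    by apply/seteqP; split => // t [/= -> ]; rewrite ltnn.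
  congr (P _); apply/seteqP; split => t /=.
    by rewrite ltnS leq_eqVlt => /predU1P[->|]; [left|right].
  by move=> [->//|/ltnW].
have Fle : {homo F : n m / (n <= m)%N >-> n <= m}.
  apply: homo_leq => [x|y x z|n]; [exact: lexx|exact: le_trans|].
  by rewrite -lee_fin FS leeDr.
have Fcvg : F n @[n --> \oo] --> (1 : R).
  apply: (@fine_cvg _ _ _ _ (P \o (fun n => N @^-1` `I_n)) 1).
  have <- : P (\bigcup_n (N @^-1` `I_n)) = 1%E.
    rewrite -(probability_setT P); congr (P _); apply/seteqP; split => // t _.
    by exists (N t).+1 => //=.
  apply: nondecreasing_cvg_mu => //; first exact: bigcup_measurable.
  move=> n m nm; apply/subsetPset => t /= /leq_trans; exact.
pose I n : set R := `[F n, F n.+1[%classic.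
have mI n : measurable (I n) by exact: measurable_itv.
have Iuniq n m u : I n u -> I m u -> n = m.
  rewrite /I /= !in_itv/= => /andP[n1 n2] /andP[m1 m2].
  have [nm|mn|//] := ltngtP n m.
  - by have := lt_le_trans (le_lt_trans m1 n2) (Fle _ _ nm); rewrite ltxx.
  - by have := lt_le_trans (le_lt_trans n1 m2) (Fle _ _ mn); rewrite ltxx.
have Iex u : 0 <= u < 1 -> exists n, I n u.
  (* The least [n] with [u < F n] is positive because [F 0 = 0]; its predecessor is the wanted
     index. *)
  move=> /andP[u0 u1]; have [n _ /(_ n (leqnn n)) /= un] := cvgr_gt _ Fcvg _ u1.
  have exn : exists n, u < F n by exists n.
  case: (ex_minnP exn) => -[|k] uk kmin; first by move: uk; rewrite F0 ltNge u0.
  exists k; rewrite /I /= in_itv/= uk andbT leNgt; apply/negP => /kmin.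
  by rewrite ltnn.
(* Points in no [I n] get the default [0]; by [Iex] they all lie outside [[0, 1[], so only
   measurability has to take them into account. *)
pose q u : nat := xget 0%N [set n | I n u].
have qI n u : I n u -> q u = n.
  move=> Inu; have H : exists n, [set n | I n u] n by exists n.
  by apply: (Iuniq _ _ u) Inu; exact: (xgetPex 0%N H).
have lebI n : lebesgue_measure (I n) = P (N @^-1` [set n]).
  have PE : P (N @^-1` [set n]) = (F n.+1 - F n)%:E.
    by rewrite EFinB FS addeK.
  (* The interval is empty exactly when [n] is not charged by the law of [N]. *)
  rewrite PE /I lebesgue_measure_itv/= lte_fin; case: ltP => [_|h].
    by rewrite EFinB.
  by congr (_%:E); apply/esym/eqP; rewrite subr_eq0 eq_le h Fle.
exists q.
  move=> _ A _; rewrite setTI.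
  rewrite (_ : q @^-1` A = (\bigcup_(n in A) I n) `|`
      ((~` \bigcup_n I n) `&` (if 0%N \in A then setT else set0))).
    apply: measurableU; first exact: bigcup_measurable.
    apply: measurableI; first by apply: measurableC; exact: bigcup_measurable.
    by case: ifP => _; [exact: measurableT|exact: measurable0].
  apply/seteqP; split => [u qA|u].
    have [[n _ Iu]|nI] := pselect ((\bigcup_n I n) u).
      by left; exists n => //; rewrite -(qI _ _ Iu).
    right; split => //; rewrite mem_set//.
    suff <- : q u = 0%N by [].
    by apply: xgetPN => n In; apply: nI; exists n.
  move=> [[n An Iu]|[nI]]; first by rewrite /= (qI _ _ Iu).
  case: ifP => // /set_mem A0 _ /=.
  by rewrite /q xgetPN// => n In; apply: nI; exists n.
move=> A.
have -> : `[0, 1[%classic `&` q @^-1` A = \bigcup_(n in A) I n.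
  apply/seteqP; split => u /=; rewrite in_itv/=.
    by move=> [u01 qA]; have [n Iu] := Iex u u01; exists n => //; rewrite -(qI _ _ Iu).
  move=> [n An Iu]; rewrite (qI _ _ Iu); split => //.
  move: Iu; rewrite /I /= in_itv/= => /andP[h1 h2].
  by rewrite (le_trans _ h1) ?(lt_le_trans h2)//= -?F0 Fle.
have -> : N @^-1` A = \bigcup_(n in A) N @^-1` [set n].
  apply/seteqP; split => t /=; first by move=> At; exists (N t).
  by move=> [n An /= ->].
have tI : trivIset A I by move=> i j _ _ [u [Iu Ju]]; exact: (Iuniq _ _ u).
have tN : trivIset A (fun n => N @^-1` [set n]) by move=> i j _ _ [t [/= <- <-]].
transitivity (\sum_(i <oo | i \in A) lebesgue_measure (I i))%E.
  by apply: measure_bigcup => // i _; exact: mI.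
rewrite (measure_bigcup _ _ _ _ tN)//.
by apply: eq_eseriesr => n _; exact: lebI.
Qed.

(** * Branching processes *)

Lemma measurable_random_index d d' (T : measurableType d) (U : measurableType d')
  (M : T -> nat) (F : nat -> T -> U) :
  measurable_fun setT M -> (forall n, measurable_fun setT (F n)) ->
  measurable_fun setT (fun t => F (M t) t).
Proof.
move=> mM mF _ A mA; rewrite setTI.
rewrite (_ : _ @^-1` A = \bigcup_n (M @^-1` [set n] `&` F n @^-1` A)).
  apply: bigcupT_measurable => n; apply: measurableI.
    exact: measurable_preimageT.
  exact: measurable_preimageT.
by apply/seteqP; split => [t At|t [n _ [/= <-]]//]; exists (M t).
Qed.

(* [Omega] is split by [(e, o)] into two independent copies of itself, as the
   space of coin tosses is by its even and odd coordinates. *)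
Section branching.
Context d (Omega : measurableType d) (R : realType) (W : probability Omega R).
Variables (e o : Omega -> Omega).
Hypotheses (me : measurable_fun setT e) (mo : measurable_fun setT o).
Hypothesis split : forall A B, measurable A -> measurable B ->
  W (e @^-1` A `&` o @^-1` B) = (W A * W B)%E.
Context dN (TN : measurableType dN) (P : probability TN R) (N : {RV P >-> nat}).
Variable M0 : Omega -> nat.
Hypotheses (mM0 : measurable_fun setT M0)
  (M0N : forall A : set nat, W (M0 @^-1` A) = P (N @^-1` A)).

(** The part [e t] decides the offspring of the root; [o t] unfolds into the independent sequence
    [e (o t)], [e (o (o t))], and so on, one independent copy of the space for each possible
    child. *)
Definition subtree i t := e (iter i o (o t)).
Definition offspring t := M0 (e t).

Lemma preserve_e A : measurable A -> W (e @^-1` A) = W A.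
Proof.
move=> mA; have := split mA measurableT.
by rewrite preimage_setT setIT probability_setT mule1.
Qed.

Lemma preserve_o A : measurable A -> W (o @^-1` A) = W A.
Proof.
move=> mA; have := split measurableT mA.
by rewrite preimage_setT setTI probability_setT mul1e.
Qed.

Lemma measurable_iter_o i : measurable_fun setT (fun t => iter i o t).
Proof.
elim: i => [|i IH]; first exact: measurable_id.
exact: (measurableT_comp mo IH).
Qed.

Lemma measurable_e_iter i : measurable_fun setT (fun t => e (iter i o t)).
Proof. exact: (measurableT_comp me (measurable_iter_o i)). Qed.

Lemma measurable_subtree i : measurable_fun setT (subtree i).
Proof. exact: (measurableT_comp (measurable_e_iter i) mo). Qed.

Lemma measurable_offspring : measurable_fun setT offspring.
Proof. exact: (measurableT_comp mM0 me). Qed.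

Lemma preserve_e_iter i A : measurable A -> W ((fun t => e (iter i o t)) @^-1` A) = W A.
Proof.
move=> mA; elim: i => [|i IH]; first exact: preserve_e.
rewrite -[RHS]IH -(preserve_o (measurable_preimageT (measurable_e_iter i) mA)).
by congr (W _); apply/seteqP; split => t /=; rewrite -iterS iterSr.
Qed.

Lemma preserve_subtree i A : measurable A -> W (subtree i @^-1` A) = W A.
Proof.
move=> mA; rewrite -(preserve_e_iter i mA).
exact: (preserve_o (measurable_preimageT (measurable_e_iter i) mA)).
Qed.

Lemma bexp_preserve (f : Omega -> Omega) (g : Omega -> R) :
  measurable_fun setT f -> (forall A, measurable A -> W (f @^-1` A) = W A) ->
  bounded_measurable g -> \int[W]_t g (f t) = \int[W]_t g t.
Proof.
move=> mf fP bg.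
have mid : measurable_fun setT (id : Omega -> Omega) by exact: measurable_id.
apply: (@bexp_law _ _ _ _ _ _ R W W (mfun_Sub (mem_set mf)) (mfun_Sub (mem_set mid)) g) => //.

Qed.

Lemma bexp_split (u v : Omega -> R) : bounded_measurable u -> bounded_measurable v ->
  \int[W]_t (u (e t) * v (o t)) = \int[W]_t u t * \int[W]_t v t.
Proof.
move=> bu bv.
rewrite -(bexp_preserve me preserve_e bu) -(bexp_preserve mo preserve_o bv).
apply: bexp_indep => // A B mA mB.
by rewrite split// preserve_e// preserve_o.
Qed.

(** Each use of [split] peels off one independent copy. *)
Lemma bexp_prod_e_iter n (g : nat -> Omega -> R) : (forall i, bounded_measurable (g i)) ->
  \int[W]_t (\prod_(i < n) g i (e (iter i o t))) = \prod_(i < n) \int[W]_t g i t.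
Proof.
elim: n g => [|n IH] g bg.
  rewrite big_ord0; under eq_Rintegral do rewrite big_ord0.
  by rewrite bexp_cst.
rewrite big_ord_recl/= -(IH (fun i => g i.+1)) => [|i]; last exact: bg.
rewrite -bexp_split//; last first.
  by apply: bm_prod => i; exact: bm_compRV (bg _) (measurable_e_iter i).
apply: eq_Rintegral => t _; rewrite big_ord_recl/=; congr (_ * _).
by apply: eq_bigr => i _; rewrite -iterS iterSr.
Qed.

Lemma bexp_offspring_prod n (h : nat -> R) (g : nat -> Omega -> R) :
  bounded_measurable h -> (forall i, bounded_measurable (g i)) ->
  \int[W]_t (h (offspring t) * \prod_(i < n) g i (subtree i t)) =
  \int[P]_t h (N t) * \prod_(i < n) \int[W]_t g i t.
Proof.
move=> bh bg.
rewrite (@bexp_split (fun t => h (M0 t)) (fun t => \prod_(i < n) g i (e (iter i o t)))).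
- rewrite bexp_prod_e_iter//; congr (_ * _).
  by apply: (@bexp_law _ _ _ _ _ _ R W P (mfun_Sub (mem_set mM0)) N) => // A mA; exact: M0N.
- exact: bm_compRV bh mM0.
- by apply: bm_prod => i; exact: bm_compRV (bg _) (measurable_e_iter i).
Qed.

Lemma bexp_prod_subtree n (g : nat -> Omega -> R) : (forall i, bounded_measurable (g i)) ->
  \int[W]_t (\prod_(i < n) g i (subtree i t)) = \prod_(i < n) \int[W]_t g i t.
Proof.
move=> bg; rewrite -(bexp_prod_e_iter n bg).
apply: (bexp_preserve (g := fun t => \prod_(i < n) g i (e (iter i o t))) mo preserve_o).
by apply: bm_prod => i; exact: bm_compRV (bg _) (measurable_e_iter i).
Qed.

Lemma offspring_law (A : set nat) : W (offspring @^-1` A) = P (N @^-1` A).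
Proof. by rewrite -M0N; apply: (preserve_e (measurable_preimageT mM0 _)). Qed.

(** The branching property: given [n] children, the product has mean [E[g] ^+ n], and averaging over
    [n] gives the generating function. *)
Lemma bexp_branching (g : Omega -> R) : bounded_measurable g -> (forall t, 0 <= g t <= 1) ->
  \int[W]_t (\prod_(i < offspring t) g (subtree i t)) = pgf N (\int[W]_t g t).
Proof.
move=> bg g01.
have E01 : 0 <= \int[W]_t g t <= 1.
  rewrite Rintegral_ge0 => [|t _]; last by case/andP: (g01 t).
  rewrite -[leRHS](bexp_cst W); apply: bexp_le => //; first exact: bm_cst.
  by move=> t; case/andP: (g01 t).
have bG n : bounded_measurable (fun t => \prod_(i < n) g (subtree i t)).
  by apply: bm_prod => i; exact: bm_compRV bg (measurable_subtree i).
apply: (@bexp_random_index _ _ _ _ R W P offspring N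
  (fun n t => \prod_(i < n) g (subtree i t)) (fun n _ => (\int[W]_t g t) ^+ n) 1) => //.
- exact: measurable_offspring.
- by move=> n; case: (bG n).
- move=> n t; rewrite ger0_norm; last first.
    by apply: prodr_ge0 => i _; case/andP: (g01 (subtree i t)).
  by apply: prodr_ile1 => i _; exact: g01.
- by move=> n t; exact: normr_exp_le1.
- move=> n; have b1 : bounded_measurable (\1_[set n] : nat -> R) by exact: bm_indic.
  have := bexp_offspring_prod n b1 (fun=> bg).
  rewrite prodr_const card_ord => H; rewrite -[LHS]/(\int[W]_t (\1_[set n] (offspring t) * _)) H.
  rewrite mulrC -bexpZ; last exact: bm_compRV b1 (measurable_funP N).
  by apply: eq_Rintegral => t _; rewrite mulrC.
Qed.

(** The recursion is made at the root, not at the last generation: generation [n.+1] gathers the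
    generations [n] of the subtrees, and this relation becomes the equation for [X] in the limit. *)
Fixpoint population n t : nat :=
  if n is n.+1 then \sum_(i < offspring t) population n (subtree i t) else 1%N.

Lemma measurable_population n : measurable_fun setT (population n).
Proof.
elim: n => [|n IH]; first exact: measurable_cst.
apply: (measurable_random_index (F := fun k t => \sum_(i < k) population n (subtree i t))).
  exact: measurable_offspring.
elim=> [|k IHk].
  by under eq_fun do rewrite big_ord0; exact: measurable_cst.
under eq_fun do rewrite big_ord_recr/=.
apply: measurable_fun_addn => //.
exact: (measurableT_comp IH (measurable_subtree k)).
Qed.

Lemma bm_exp_population (x : R) n : 0 <= x <= 1 ->
  bounded_measurable (fun t => x ^+ population n t).
Proof.
move=> x01; apply: (@bm_bound _ _ _ _ 1); last by move=> t; exact: normr_exp_le1.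
by apply: (measurableT_comp (f := fun k => x ^+ k)) => //; exact: measurable_population.
Qed.

Lemma iter_pgf01 n (x : R) : 0 <= x <= 1 -> 0 <= iter n (pgf N) x <= 1.
Proof.
move=> x01; elim: n => //= n /[dup] H /andP[h0 h1].
by rewrite pgf_ge0//= pgf_le1.
Qed.

(** The joint generating function of two generations; it provides all the first and second moments
    used for the martingale. *)
Lemma bexp_population2 n k (x y : R) : 0 <= x <= 1 -> 0 <= y <= 1 ->
  \int[W]_t (x ^+ population n t * y ^+ population (n + k) t) =
  iter n (pgf N) (x * iter k (pgf N) y).
Proof.
move=> x01 y01.
have step n' (G : Omega -> R) (H : Omega -> R) : bounded_measurable G ->
    (forall t, 0 <= G t <= 1) ->
    (forall t, H t = \prod_(i < offspring t) G (subtree i t)) ->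
    \int[W]_t G t = n' -> \int[W]_t H t = pgf N n'.
  move=> bG G01 HG <-; rewrite -bexp_branching//.
  by apply: eq_Rintegral => t _; exact: HG.
have xn01 m (z : R) t : 0 <= z <= 1 -> 0 <= z ^+ population m t <= 1.
  by move=> /andP[z0 z1]; rewrite exprn_ge0//= exprn_ile1.
elim: n => [|n IH].
  under eq_Rintegral do rewrite expr1.
  rewrite bexpZ; last by rewrite add0n; exact: bm_exp_population.
  congr (_ * _); rewrite add0n; elim: k => [|k IHk].
    by under eq_Rintegral do rewrite expr1; rewrite bexp_cst.
  apply: (step _ (fun t => y ^+ population k t)) => //=.
  - exact: bm_exp_population.
  - by move=> t; exact: xn01.
  - by move=> t; rewrite expr_sum.
apply: (step _ (fun t => x ^+ population n t * y ^+ population (n + k) t)) => //=.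
- by apply: bmM; exact: bm_exp_population.
- move=> t; have /andP[a0 a1] := xn01 n x t x01.
  have /andP[b0 b1] := xn01 (n + k)%N y t y01.
  by rewrite mulr_ge0//= mulr_ile1.
- by move=> t; rewrite big_split/= !expr_sum.
Qed.

Lemma mutually_independent_subtree (X : Omega -> R) (Y : nat -> {RV W >-> R}) :
  measurable_fun setT X -> (forall i, Y i =1 X \o subtree i) -> mutually_independent Y.
Proof.
move=> mX YX J A mA.
(* The index set is enlarged to an initial segment, with the full set as the event at each added
   index, so that the product formula over [i < k] applies. *)
pose k := (\max_(i <- J) i).+1.
have Jk i : i \in J -> (i < k)%N by move=> iJ; rewrite ltnS leq_bigmax_seq.
pose B i := if i \in J then A i else setT.
have mB i : measurable (B i) by rewrite /B; case: ifPn => // /mA.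
have mXB i : measurable (X @^-1` B i) by exact: measurable_preimageT.
have mYB i : measurable (Y i @^-1` B i).
  by apply: measurable_preimageT => //; exact: measurable_funP.
have YE i : W (Y i @^-1` B i) = W (X @^-1` B i).
  rewrite -(preserve_subtree i (mXB i)); congr (W _).
  by apply/seteqP; split => t /=; rewrite YX.
have -> : \bigcap_(i in [set` J]) (Y i @^-1` A i) = \bigcap_(i < k) (Y i @^-1` B i).
  apply/seteqP; split => t H i /=.
    by move=> ik; rewrite /B; case: ifPn => // iJ; exact: H.
  by move=> iJ; have := H i (Jk i iJ); rewrite /= /B iJ.
have -> : (\prod_(i <- J) W (Y i @^-1` A i) = \prod_(i < k) W (Y i @^-1` B i))%E.
  rewrite -(big_mkord xpredT (fun i => W (Y i @^-1` B i))) [RHS](bigID (mem J))/=.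
  rewrite [X in _ = (_ * X)%E]big1 ?mule1; last first.
    by move=> i iJ; rewrite /B ifN// preimage_setT probability_setT.
  rewrite -[RHS]big_filter [RHS](perm_big (enum_fset J)).
    by apply: eq_big_seq => i iJ; rewrite /B iJ.
  apply: uniq_perm; [exact/filter_uniq/iota_uniq|exact: fset_uniq|].
  move=> i; rewrite mem_filter mem_index_iota /=.
  by have [/Jk ->|] := boolP (i \in J).
have mI : measurable (\bigcap_(i < k) (Y i @^-1` B i)).
  by apply: bigcap_measurableType.
rewrite -[LHS]fineK ?fin_num_measure//.
under eq_bigr => i _ do rewrite YE -[W _]fineK ?fin_num_measure// -bexp_indic//.
rewrite prodEFin -(bexp_prod_subtree k (g := fun i => \1_(X @^-1` B i))); last by move=> i; exact: bm_indic.
rewrite -bexp_indic//; congr (_%:E); apply: eq_Rintegral => t _.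
rewrite indicE; have [/set_mem tI|tI] := boolP (t \in _).
  rewrite big1// => i _; rewrite indicE mem_set//.
  by have := tI i (ltn_ord i); rewrite /= YX.
apply/esym/eqP; rewrite prodf_seq_eq0; apply/hasP.
have : ~ (forall i : 'I_k, B i (X (subtree i t))).
  move=> H; move/negP: tI; apply; apply/mem_set => i ik.
  by rewrite /= YX; exact: (H (Ordinal ik)).
move=> /existsNP[i Bi]; exists i; first by rewrite mem_index_enum.
by rewrite /= indicE memNset.
Qed.

(** Every [Y i] factors through [o], so each event of their sigma-algebra is an [o]-preimage,
    whereas [M] factors through [e]. *)
Lemma independent_of_subtree (X : Omega -> R) (Y : nat -> {RV W >-> R})
    (M : {RV W >-> nat}) :
  measurable_fun setT X -> (forall i, Y i =1 X \o subtree i) -> M =1 offspring ->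
  independent_of_family M Y.
Proof.
move=> mX YX ME B E mB sE.
have [E' mE' <-] : preimage_set_system setT o measurable E.
  apply: sE; split.
    apply: sigma_algebra_preimage; exact: sigma_algebra_measurable.
  move=> _ [i _ [A mA <-]].
  exists ((fun t => X (e (iter i o t))) @^-1` A).
    by apply: measurable_preimageT => //; exact: (measurableT_comp mX (measurable_e_iter i)).
  by apply/seteqP; split => t /=; rewrite YX.
have -> : M @^-1` B = e @^-1` (M0 @^-1` B) by apply/seteqP; split => t /=; rewrite ME.
have mM0B : measurable (M0 @^-1` B) by exact: measurable_preimageT.
by rewrite setTI split// preserve_e// preserve_o.
Qed.

End branching.

(** * Backward orbits of the generating function *)

Section backward_orbit.
Context d (T : measurableType d) (R : realType) (P : probability T R).
Variables (N : {RV P >-> nat}) (m : R).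
Hypotheses (m1 : 1 < m) (Em : ('E_P[fun t => (N t)%:R : R] = m%:E)%E).

Let f := pgf N.

Let slope_le s : 0 <= s <= 1 -> 1 - f s <= m * (1 - s).
Proof.
move=> /andP[s0 s1]; have := @pgf_lipschitz _ _ _ P N m Em 1 s.
rewrite lexx ler01 s0 s1 pgf1 => /(_ isT isT).
by rewrite [X in _ <= _ * X]ger0_norm ?subr_ge0//; apply: le_trans; exact: ler_norm.
Qed.

(** As [f] has slope larger than some [A > 1] near [1], the fixed point [1] is repelling: [f] lies
    below the diagonal there, the intermediate value theorem supplies preimages, and these approach
    [1] at the rate [A^-1 ^+ n]. *)
Lemma exists_backward_orbit : exists (s0 : R) (h : nat -> R),
  [/\ 0 < s0, (forall s, s0 <= s < 1 -> f s < s), h 0%N = s0,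
      (forall n, s0 <= h n < 1) &
      (forall n, f (h n.+1) = h n) /\ h n @[n --> \oo] --> (1 : R)].
Proof.
pose A := (1 + m) / 2.
have m1' := m1.
have A1 : 1 < A by rewrite /A; lra.
have Am : A < m by rewrite /A; lra.
have [] := @pgf_slope _ _ _ P N A; first by rewrite Em lte_fin.
move=> s1 /andP[s10 s11] H1.
(* The maximum makes [s0] positive, as the logarithms of the orbit require. *)
pose s0 := Num.max s1 2^-1.
have s0_gt0 : 0 < s0 by rewrite lt_max invr_gt0 ltr0n orbT.
have s01 : s0 < 1 by rewrite gt_max s11 invf_lt1// ltr1n.
have fs s : s0 <= s < 1 -> f s < s.
  move=> /andP[s0s s1']; have : A * (1 - s) <= 1 - f s.
    by apply: H1; rewrite (ltW s1') andbT (le_trans _ s0s)// le_max lexx.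
  have : 0 < 1 - s by rewrite subr_gt0.
  by nra.
have pre y : s0 <= y < 1 -> exists c, s0 <= c < 1 /\ f c = y.
  move=> /andP[s0y y1].
  have cf : {within `[s0, 1], continuous f}.
    apply/subspace_continuousP => x /=; rewrite in_itv/= => /andP[sx x1].
    apply/cvgrPdist_lt => eps eps0; near=> z.
    have : z \in `[s0, 1] by near: z; exact: withinT.
    rewrite in_itv/= => /andP[sz z1].
    rewrite (le_lt_trans (@pgf_lipschitz _ _ _ P N m Em _ _ _ _))//.
    - by rewrite x1 (le_trans (ltW s0_gt0)).
    - by rewrite z1 (le_trans (ltW s0_gt0)).
    rewrite mulrC -ltr_pdivlMr; last by rewrite (lt_trans ltr01).
    near: z; apply: cvg_within.
    apply: nbhsx_ballx.
    by rewrite divr_gt0// (lt_trans ltr01).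
  have f1 : f 1 = 1 by exact: pgf1.
  have fs0 : f s0 < s0 by apply: fs; rewrite lexx.
  have [|c] := @IVT _ f s0 1 y (ltW s01) cf.
    have fs1 : f s0 <= 1 by rewrite (le_trans (ltW fs0))// ltW.
    by rewrite f1 (min_l fs1) (max_r fs1) (ltW y1) (le_trans (ltW fs0)).
  rewrite in_itv/= => /andP[sc c1] fc; exists c; split => //.
  rewrite sc lt_neqAle c1 andbT; apply/eqP => c1'.
  by move: fc y1; rewrite c1' f1 => <-; rewrite ltxx.
pose g y := xget 0 [set c | s0 <= c < 1 /\ f c = y].
have gP y : s0 <= y < 1 -> s0 <= g y < 1 /\ f (g y) = y.
  by move=> /pre H; have := xgetPex 0 H.
pose h n := iter n g s0.
have hP n : s0 <= h n < 1 by elim: n => [|n /gP[]//]; rewrite lexx.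
have fh n : f (h n.+1) = h n by have [] := gP _ (hP n).
exists s0, h; split=> //; split=> //.
have hle n : 1 - h n <= A^-1 ^+ n.
  elim: n => [|n IH]; first by rewrite lerBlDr lerDl ltW.
  rewrite exprS mulrC ler_pdivlMr; last exact: lt_trans A1.
  have /andP[hs h1'] := hP n.+1.
  rewrite mulrC (le_trans _ IH)// -(fh n); apply: H1.
  by rewrite (ltW h1') andbT (le_trans _ hs)// le_max lexx.
have c0 : A^-1 ^+ n @[n --> \oo] --> (0 : R).
  have A0 : 0 < A by exact: lt_trans A1.
  by apply: cvg_expr; rewrite gtr0_norm ?invr_gt0// invf_lt1.
have : 1 - h n @[n --> \oo] --> (0 : R).
  apply: (@squeeze_cvgr _ _ _ _ (fun=> 0) _ _ _ _ (cvg_cst 0) c0).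
  by apply: nearW => n; rewrite hle andbT subr_ge0 ltW//; have /andP[] := hP n.
move=> c1; rewrite -[X in _ --> X]subr0.
rewrite (_ : h = fun n => 1 - (1 - h n)); last by apply/funext => n; rewrite subKr.
by apply: cvgB => //; exact: cvg_cst.
Unshelve. all: end_near. Qed.

(** The ratio of [1 - h n] to [1 - h n.+1] tends to [m] by [pgf_slope] from below and
    [pgf_lipschitz] from above; [1 - x <= - ln x <= (1 - x) / x] carries this over to logarithms. *)
Lemma backward_orbit_ratio (s0 : R) (h : nat -> R) :
  (forall n, s0 <= h n < 1) -> 0 < s0 -> (forall n, f (h n.+1) = h n) ->
  h n @[n --> \oo] --> (1 : R) ->
  ln (h n) / ln (h n.+1) @[n --> \oo] --> m.
Proof.
move=> h01 s00 fh h1.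
have hn0 n : 0 < h n by have /andP[h0 _] := h01 n; exact: lt_le_trans h0.
have hn1 n : h n < 1 by have /andP[] := h01 n.
have hS1 : h n.+1 @[n --> \oo] --> (1 : R) by rewrite (cvg_shiftS h).
pose a n := (1 - h n) / (1 - h n.+1).
have am : a n @[n --> \oo] --> m.
  apply/cvgrPdist_le => eps eps0.
  have [] := @pgf_slope _ _ _ P N (m - eps); first by rewrite Em lte_fin ltrBlDr ltrDl.
  move=> s1 /andP[s10 s11] H1.
  near=> n.
  have hs1 : s1 <= h n.+1.
    by near: n; apply: (cvgr_ge 1 hS1).
  have d0 : 0 < 1 - h n.+1 by rewrite subr_gt0.
  have : (m - eps) * (1 - h n.+1) <= 1 - f (h n.+1) by apply: H1; rewrite hs1 ltW.
  have : 1 - f (h n.+1) <= m * (1 - h n.+1) by apply: slope_le; rewrite !ltW.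
  rewrite fh -!ler_pdivlMr// -/(a n) -ler_pdivrMr// -/(a n) => a1 a2.
  by rewrite ler_distlC; apply/andP; split; lra.
have ln_up (x : R) : 0 < x -> ln x <= x - 1.
  by move=> x0; have := @le_ln1Dx R (x - 1); rewrite (addrC 1) subrK; apply; rewrite ltrBrDr addNr.
have l_ge n : 1 - h n <= - ln (h n) by have := ln_up _ (hn0 n); lra.
have l_le n : - ln (h n) <= (1 - h n) / h n.
  have := ln_up (h n)^-1; rewrite invr_gt0 lnV ?posrE// => /(_ (hn0 n)).
  by rewrite mulrBl mul1r divff ?gt_eqF.
have l_gt0 n : 0 < - ln (h n) by rewrite (lt_le_trans _ (l_ge n))// subr_gt0.
have ratioE n : ln (h n) / ln (h n.+1) = - ln (h n) / - ln (h n.+1).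
  by rewrite invrN mulrNN.
have aE n : a n * (1 - h n.+1) = 1 - h n by rewrite divfK// gt_eqF// subr_gt0.
have a0 n : 0 <= a n by rewrite divr_ge0// subr_ge0 ltW.
have lower n : h n.+1 * a n <= ln (h n) / ln (h n.+1).
  rewrite ratioE ler_pdivlMr// (le_trans _ (l_ge n))// -aE mulrAC [leRHS]mulrC.
  rewrite ler_wpM2r//; have := l_le n.+1; rewrite ler_pdivlMr// mulrC; exact.
have upper n : ln (h n) / ln (h n.+1) <= a n / h n.
  rewrite ratioE ler_pdivrMr// (le_trans (l_le n))// -aE mulrAC.
  by rewrite ler_wpM2l// divr_ge0// ltW.
apply: (@squeeze_cvgr _ _ _ _ (fun n => h n.+1 * a n) (fun n => a n / h n)).
- by apply: nearW => n; rewrite lower upper.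
- by rewrite -[X in _ --> X]mul1r; apply: cvgM.
- have -> : m = m * 1^-1 by rewrite invr1 mulr1.
  by apply: cvgM => //; apply: cvgV => //; exact: oner_neq0.
Unshelve. all: end_near. Qed.

End backward_orbit.

(** * Almost sure convergence along a subsequence *)

Section almost_sure_subsequence.
Context d (T : measurableType d) (R : realType) (P : probability T R).

(** By Tonelli the sum of the series has mean at most [2 * C], so it is almost surely finite. *)
Lemma ae_cvg_series (V : nat -> T -> R) (C : R) :
  (forall j, bounded_measurable (V j)) -> (forall j t, 0 <= V j t) ->
  (forall j, \int[P]_t V j t <= C * 2^-1 ^+ j) ->
  {ae P, forall t, cvgn (series (fun j => V j t))}.
Proof.
move=> bV V0 EV.
have mV j : measurable_fun setT (fun t => (V j t)%:E).
  by apply/measurable_EFinP; case: (bV j).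
have C0 : 0 <= C.
  by have := EV 0%N; rewrite expr0 mulr1; apply: le_trans; exact: Rintegral_ge0.
have bnd n : \sum_(0 <= j < n) \int[P]_t V j t <= C * 2.
  rewrite (@le_trans _ _ (C * \sum_(0 <= j < n) 2^-1 ^+ j))//.
    by rewrite mulr_sumr; apply: ler_sum => j _; exact: EV.
  rewrite ler_wpM2l// big_mkord.
  have := geometric_sumE (2^-1 : R) n.
  have : 0 <= (2^-1 : R) ^+ n by rewrite exprn_ge0.
  by set x := _ ^+ n; set y := \sum_(_ < _) _ => x0 xy; lra.
have lty : (\int[P]_t (\sum_(j <oo) (V j t)%:E) < +oo)%E.
  rewrite integral_nneseries//; last by move=> j t _; rewrite lee_fin.
  rewrite (le_lt_trans _ (ltry (C * 2)))//.
  apply: lime_le; first by apply: is_cvg_nneseries => j _ _; apply: integral_ge0 => t _; rewrite lee_fin.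
  apply: nearW => n.
  under eq_bigr do rewrite -bm_EFin//.
  by rewrite sumEFin lee_fin.
have S0 t : (0 <= \sum_(j <oo) (V j t)%:E)%E.
  by apply: nneseries_ge0 => j _ _; rewrite lee_fin.
have mS : measurable_fun setT (fun t => \sum_(j <oo) (V j t)%:E)%E.
  by apply: ge0_emeasurable_sum => [k t _ _|k _ //]; rewrite lee_fin.
have : {ae P, forall t, (\sum_(j <oo) (V j t)%:E)%E \is a fin_num}.
  have iS : P.-integrable setT (fun t => \sum_(j <oo) (V j t)%:E)%E.
    apply/integrableP; split => //.
    by under eq_integral do rewrite gee0_abs//.
  by apply: filterS (integrable_ae measurableT iS) => t; apply.
apply: filterS => t fin; apply: nondecreasing_is_cvgn.
  move=> n k nk; rewrite /series/= -subr_ge0 sub_series_geq//.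
  by apply: sumr_ge0.
exists (fine (\sum_(j <oo) (V j t)%:E)%E) => _ [n _ <-].
rewrite -lee_fin fineK// /series/= -sumEFin.
by apply: nneseries_lim_ge => j _; rewrite lee_fin.
Qed.

(** The last hypothesis is the orthogonality of martingale increments, [q n] standing for the second
    moment of [U n]. Then [q] is nondecreasing and bounded, and [U] is Cauchy in mean square. *)
Lemma ae_subsequence (U : nat -> T -> R) (q : nat -> R) :
  (forall n, measurable_fun setT (U n)) -> (forall n t, 0 <= U n t <= 1) ->
  (forall n, q n <= 1) ->
  (forall n k, \int[P]_t (U (n + k)%N t - U n t) ^+ 2 = q (n + k)%N - q n) ->
  exists (phi : nat -> nat) (L : T -> R),
    [/\ forall j, (j <= phi j)%N, measurable_fun setT L, forall t, 0 <= L t <= 1 &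
     {ae P, forall t, U (phi j) t @[j --> \oo] --> L t /\
                      U (phi j).+1 t @[j --> \oo] --> L t}].
Proof.
move=> mU U01 q1 Uq.
have bU n : bounded_measurable (U n).
  by apply: (@bm_bound _ _ _ _ 1) => // t; rewrite ger0_norm; case/andP: (U01 n t).
have qnd n k : q n <= q (n + k)%N.
  by rewrite -subr_ge0 -Uq; apply: Rintegral_ge0 => t _; exact: sqr_ge0.
have qcvg : cvgn q.
  apply: nondecreasing_is_cvgn; last by exists 1 => _ [n _ <-].
  by move=> n k /subnKC <-.
have qlim n : q n <= limn q.
  by apply: nondecreasing_cvgn_le => // i k /subnKC <-.
(* A bound [4^-1 ^+ j] in mean square becomes the summable [2^-1 ^+ j] in mean. *)
have /choice[n0 Hn0] j : exists n0, forall n k, (n0 <= n)%N ->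
    q (n + k)%N - q n <= 4^-1 ^+ j.
  have e0 : 0 < (4^-1 : R) ^+ j by rewrite exprn_gt0.
  have /cvgrPdist_le /(_ _ e0)[n0 _ H] := qcvg.
  exists n0 => n k n0n; have := H n n0n.
  rewrite /= ger0_norm ?subr_ge0 ?qlim// => h.
  by have := qlim (n + k)%N; lra.
pose phi := fix phi j := if j is j.+1 then maxn (phi j).+1 (n0 j.+1) else n0 0%N.
have phin0 j : (n0 j <= phi j)%N by case: j => [|j]//=; rewrite leq_maxr.
have phiS j : (phi j < phi j.+1)%N by rewrite /= leq_max ltnSn.
(* The first term makes the subsequence converge; the second forces its shift by one to have the
   same limit. *)
pose V j t := `|U (phi j.+1) t - U (phi j) t| + `|U (phi j).+1 t - U (phi j) t|.
have bd n k : bounded_measurable (fun t => U n t - U k t) by exact: bmB.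
have bV j : bounded_measurable (V j) by apply: bmD; apply: bm_norm.
have Eabs j k : \int[P]_t `|U (phi j + k)%N t - U (phi j) t| <= 2^-1 ^+ j.
  have x0 : 0 < (2^-1 : R) ^+ j by rewrite exprn_gt0.
  set x := _ ^+ j in x0 *.
  have x2 : x * x = 4^-1 ^+ j.
    by rewrite -exprMn; congr (_ ^+ _); rewrite -invfM -natrM.
  (* AM-GM: [|y| <= (x + y^2 / x) / 2] *)
  have : \int[P]_t `|U (phi j + k)%N t - U (phi j) t| <=
      \int[P]_t (x / 2 + (2 * x)^-1 * (U (phi j + k)%N t - U (phi j) t) ^+ 2).
    apply: bexp_le; first exact: bm_norm.
      by apply: bmD; [exact: bm_cst|apply: bmM; [exact: bm_cst|exact: (bmX 2 (bd _ _))]].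
    move=> t; set y := _ - _; rewrite -(real_normK (num_real y)).
    rewrite -subr_ge0 (_ : _ - _ = (2 * x)^-1 * (`|y| - x) ^+ 2).
      by rewrite mulr_ge0 ?sqr_ge0// invr_ge0 mulr_ge0// ltW.
    by field; rewrite gt_eqF.
  move/le_trans; apply.
  rewrite bexpD; [|exact: bm_cst|apply: bmM; [exact: bm_cst|exact: (bmX 2 (bd _ _))]].
  rewrite bexp_cst bexpZ; last exact: (bmX 2 (bd _ _)).
  rewrite Uq; have := Hn0 j (phi j) k (phin0 j).
  rewrite -x2 => h.
  rewrite -lerBrDl (_ : x - x / 2 = (2 * x)^-1 * (x * x)); last first.
    by field; rewrite gt_eqF.
  by rewrite ler_wpM2l// invr_ge0 mulr_ge0// ltW.
have EV j : \int[P]_t V j t <= 2 * 2^-1 ^+ j.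
  rewrite /V bexpD; [|exact: bm_norm|exact: bm_norm].
  have := Eabs j (phi j.+1 - phi j)%N; rewrite subnKC; last exact: ltnW.
  have := Eabs j 1%N; rewrite addn1.
  by set a := Rintegral _ _ _; set b := Rintegral _ _ _; lra.
have cV : {ae P, forall t, cvgn (series (fun j => V j t))}.
  apply: (ae_cvg_series bV) EV => j t; exact: addr_ge0.
(* The upper limit is measurable and defined everywhere; clamping it gives values in [[0, 1]] at
   every point and changes nothing where the subsequence converges. *)
pose L t := limn_sup (fun j => U (phi j) t).
pose L' t := Num.min 1 (Num.max 0 (L t)).
exists phi, L'; split.
- by elim=> [//|j IH]; exact: leq_ltn_trans IH (phiS j).
- apply: measurable_minr; first exact: measurable_cst.
  apply: measurable_maxr; first exact: measurable_cst.
  apply: measurable_fun_limn_sup => //.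
  + by move=> t _; exists 1 => _ [j _ <-]; case/andP: (U01 (phi j) t).
  + by move=> t _; exists 0 => _ [j _ <-]; case/andP: (U01 (phi j) t).
- by move=> t; rewrite le_min ler01 le_max lexx/= ge_min lexx.
apply: filterS cV => t Vt.
have V0 j : 0 <= V j t by exact: addr_ge0.
have sub (u : nat -> R) : (forall j, `|u j| <= V j t) -> cvgn (series u).
  move=> uV; apply: normed_cvg.
  by apply: (series_le_cvg _ _ _ Vt) => // j; exact: normr_ge0.
have Ucvg : cvgn (fun j => U (phi j) t).
  have : cvgn (series (telescope (fun j => U (phi j) t))).
    by apply: sub => j; rewrite /telescope lerDl.
  rewrite telescopeK => c.
  rewrite (_ : (fun j => _) = (fun j => (U (phi j) t - U (phi 0%N) t) + U (phi 0%N) t)).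
    by apply: is_cvgD => //; exact: is_cvg_cst.
  by apply/funext => j; rewrite subrK.
have UL : U (phi j) t @[j --> \oo] --> L t.
  by rewrite /L cvg_limn_supE.
have L01 : 0 <= L t <= 1.
  apply/andP; split.
    by apply: (cvgr_to_ge UL); apply: nearW => j; case/andP: (U01 (phi j) t).
  by apply: (cvgr_to_le UL); apply: nearW => j; case/andP: (U01 (phi j) t).
have -> : L' t = L t.
  by rewrite /L'; case/andP: L01 => l0 l1; rewrite max_r// min_r.
split => //.
have c0 : U (phi j).+1 t - U (phi j) t @[j --> \oo] --> (0 : R).
  by apply: cvg_series_cvg_0; apply: sub => j; rewrite lerDr.
rewrite -[X in _ --> X]add0r.
rewrite (_ : (fun j => U (phi j).+1 t) = (fun j => (U (phi j).+1 t - U (phi j) t) + U (phi j) t)).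
  exact: cvgD.
by apply/funext => j; rewrite subrK.
Qed.

End almost_sure_subsequence.

(** * The limit of the normalized branching process *)

Section branching_limit.
Context d (Omega : measurableType d) (R : realType) (W : probability Omega R).
Variables (e o : Omega -> Omega).
Hypotheses (me : measurable_fun setT e) (mo : measurable_fun setT o).
Hypothesis split : forall A B, measurable A -> measurable B ->
  W (e @^-1` A `&` o @^-1` B) = (W A * W B)%E.
Context dN (TN : measurableType dN) (P : probability TN R) (N : {RV P >-> nat}).
Variable M0 : Omega -> nat.
Hypotheses (mM0 : measurable_fun setT M0)
  (M0N : forall A : set nat, W (M0 @^-1` A) = P (N @^-1` A)).

(** Passing to a subtree preserves [W], so null sets pull back to null sets, and there are countably
    many subtrees. *)
Lemma ae_subtree (A : Omega -> Prop) : {ae W, forall t, A t} ->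
  {ae W, forall t i, A (subtree e o i t)}.
Proof.
move=> [B [mB B0 AB]]; apply/ae_foralln => i.
exists (subtree e o i @^-1` B); split.
- exact: (measurable_preimageT (measurable_subtree me mo i) mB).
- by rewrite -B0; exact: (preserve_subtree me mo split i mB).
- by move=> t; exact: AB.
Qed.

Variable m : R.
Hypotheses (m1 : 1 < m) (Em : ('E_P[fun t => (N t)%:R : R] = m%:E)%E).

Let th := subtree e o.
Let rt := offspring e M0.
Let Z := population e o M0.

Lemma exists_branching_limit : exists X : Omega -> R,
  [/\ measurable_fun setT X, ~ {ae W, forall t, X t = 0} &
   {ae W, forall t, m * X t = \sum_(i < offspring e M0 t) X (subtree e o i t)}].
Proof.
have [s0 [h [s0_gt0 fs h0 h01 [fh h1]]]] := exists_backward_orbit m1 Em.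
have ratio := backward_orbit_ratio Em h01 s0_gt0 fh h1.
have hn0 n : 0 < h n by have /andP[hs _] := h01 n; exact: lt_le_trans hs.
have hn1 n : h n < 1 by have /andP[] := h01 n.
have h01' n : 0 <= h n <= 1 by rewrite !ltW.
have iterh n k : iter k (pgf N) (h (n + k)%N) = h n.
  by elim: k n => [|k IH] n; rewrite ?addn0//= addnS -addSn IH fh.
pose U n t : R := h n ^+ Z n t.
have U01 n t : 0 <= U n t <= 1.
  by have /andP[a b] := h01' n; rewrite exprn_ge0//= exprn_ile1.
have bU n : bounded_measurable (U n).
  exact: (bm_exp_population me mo mM0 n (h01' n)).
(* The second moment of [U n]. By [iterh] the mixed moment of [U n] and [U (n + k)] has the same
   value, which is the martingale orthogonality. *)
pose q n := iter n (pgf N) (h n * h n).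
have E2 n k : \int[W]_t (h n ^+ Z n t * h (n + k)%N ^+ Z (n + k)%N t) = q n.
  by rewrite (bexp_population2 me mo split mM0 M0N)// iterh.
have EU n : \int[W]_t U n t = s0.
  have := bexp_population2 me mo split mM0 M0N n 0 (x := 1) (y := h n).
  rewrite lexx ler01 h01' => /(_ isT isT) /=; rewrite mul1r addn0.
  have -> : iter n (pgf N) (h n) = s0 by rewrite -h0 -[X in h X]add0n iterh.
  by under eq_Rintegral do rewrite expr1n mul1r.
have q1 n : q n <= 1.
  have /(iter_pgf01 N n) /andP[] // : 0 <= h n * h n <= 1.
  by have /andP[a b] := h01' n; rewrite mulr_ge0//= mulr_ile1.
have Uq n k : \int[W]_t (U (n + k)%N t - U n t) ^+ 2 = q (n + k)%N - q n.
  have bUU i j : bounded_measurable (fun t => U i t * U j t) by exact: bmM.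
  transitivity (\int[W]_t (U (n + k)%N t * U (n + k)%N t + U n t * U n t
      - 2 * (U n t * U (n + k)%N t))).
    by apply: eq_Rintegral => t _; ring.
  rewrite bexpB; [|exact: bmD|by apply: bmM => //; exact: bm_cst].
  rewrite bexpD// bexpZ// E2.
  have := E2 (n + k)%N 0%N; rewrite addn0 => ->.
  by have := E2 n 0%N; rewrite addn0 => ->; ring.
have mU n : measurable_fun setT (U n) by case: (bU n).
have [phi [L [phige mL L01 UL]]] := ae_subsequence mU U01 q1 Uq.
have ULth := ae_subtree UL.
have bL : bounded_measurable L.
  by apply: (@bm_bound _ _ _ _ 1) => // t; rewrite ger0_norm; case/andP: (L01 t).
have EL : \int[W]_t L t = s0.
  have c1 : \int[W]_t U (phi j) t @[j --> \oo] --> \int[W]_t L t.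
    apply: (@bexp_cvg _ _ _ _ _ _ 1) => //.
      by move=> j t; rewrite ger0_norm; case/andP: (U01 (phi j) t).
    by apply: filterS UL => t [].
  have c2 : (fun j => \int[W]_t U (phi j) t) = fun=> s0 by apply/funext => j; exact: EU.
  by rewrite c2 in c1; apply: (cvg_unique _ c1 (cvg_cst s0)).
pose l n := - ln (h n).
have l0 n : 0 < l n by rewrite oppr_gt0 ln_lt0// hn0 hn1.
have rl n : l n / l n.+1 = ln (h n) / ln (h n.+1) by rewrite /l invrN mulrNN.
have rcvg : l n / l n.+1 @[n --> \oo] --> m by under eq_fun do rewrite rl.
have phiy : phi j @[j --> \oo] --> \oo.
  apply/cvgnyPge => A; near=> j.
  by apply: leq_trans (phige j); near: j; exact: nbhs_infty_ge.
have rphi : l (phi j) / l (phi j).+1 @[j --> \oo] --> m.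
  exact: (cvg_comp _ _ phiy rcvg).
have lnU n t : - ln (U n t) = l n * (Z n t)%:R.
  by rewrite lnXn// /l mulNr mulr_natr.
have UE n t : U n t = expR (- (l n * (Z n t)%:R)).
  by rewrite -lnU opprK lnK// posrE exprn_gt0.
have lcvg (phi' : nat -> nat) t : U (phi' j) t @[j --> \oo] --> L t -> 0 < L t ->
    l (phi' j) * (Z (phi' j) t)%:R @[j --> \oo] --> - ln (L t).
  move=> UL' Lt0; under eq_fun do rewrite -lnU.
  by apply: cvgN; apply: continuous_cvg => //; exact: continuous_ln.
have ZS n t : Z n.+1 t = (\sum_(i < rt t) Z n (th i t))%N by [].
(* Generation [(phi j).+1] normalized by [l (phi j)], the factor suited to its subtrees; the
   mismatch produces the factor [m]. *)
have lS t : U (phi j).+1 t @[j --> \oo] --> L t -> 0 < L t ->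
    l (phi j) * (Z (phi j).+1 t)%:R @[j --> \oo] --> m * - ln (L t).
  move=> UL' Lt0.
  have -> : (fun j => l (phi j) * (Z (phi j).+1 t)%:R) =
      (fun j => (l (phi j) / l (phi j).+1) * (l (phi j).+1 * (Z (phi j).+1 t)%:R)).
    by apply/funext => j; rewrite mulrA divfK// gt_eqF.
  by apply: cvgM => //; exact: (lcvg (fun j => (phi j).+1)).
(* The population of one subtree is at most that of the tree one generation later, so its normalized
   size stays bounded and [U] on the subtree stays away from [0]. *)
have Lpos : {ae W, forall t, 0 < L t -> forall i, (i < rt t)%N -> 0 < L (th i t)}.
  apply: filterS2 UL ULth => t [_ U2] Uth Lt0 i ilt.
  have [Ui _] := Uth i.
  have := lS t U2 Lt0; set b := m * _ => cb.
  have : \forall j \near \oo, l (phi j) * (Z (phi j).+1 t)%:R <= b + 1.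
    by apply: (cvgr_le b cb); rewrite ltrDl.
  move=> H; have : expR (- (b + 1)) <= L (th i t).
    apply: (cvgr_to_ge Ui); apply: filterS H => j Hj.
    rewrite UE ler_expR lerN2 (le_trans _ Hj)// ler_wpM2l ?(ltW (l0 _))//.
    by rewrite ler_nat ZS (bigD1 (Ordinal ilt))//= leq_addr.
  by apply: lt_le_trans; exact: expR_gt0.
pose I t : R := \1_[set x : R | 0 < x] (L t).
have mpos : measurable [set x : R | 0 < x].
  by rewrite -set_itvoy; exact: measurable_itv.
have bI : bounded_measurable I by apply: (bm_compRV _ mL); exact: bm_indic.
have I01 t : 0 <= I t <= 1 by rewrite /I indicE ler0n lern1; case: (_ \in _).
(* With [p = P(L > 0)]: [s0 = E[L] <= p] because [L] is at most the indicator, and [p <= f(p)]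
   because positivity is inherited by the subtrees. As [f(s) < s] on [[s0, 1)], only [p = 1]
   remains. *)
have EI : \int[W]_t I t = 1.
  set p := \int[W]_t I t.
  have p1 : p <= 1.
    rewrite -[leRHS](bexp_cst W); apply: bexp_le => //; first exact: bm_cst.
    by move=> t; case/andP: (I01 t).
  have sp : s0 <= p.
    rewrite -EL; apply: bexp_le => // t; rewrite /I indicE.
    have /andP[L0 L1] := L01 t.
    have [_//|] := boolP (_ \in _); move=> /negP nL; rewrite /= leNgt; apply/negP => H.
    by apply: nL; apply/mem_set.
  have : p <= pgf N p.
    rewrite -(bexp_branching me mo split mM0 M0N bI I01).
    pose Pi t := \prod_(i < rt t) I (th i t).
    have bIn n : bounded_measurable (fun t => \prod_(i < n) I (th i t)).
      apply: (@bm_prod _ Omega R 'I_n (index_enum 'I_n) (fun i t => I (th i t))) => i.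
      exact: (bm_compRV bI (measurable_subtree me mo i)).
    have bPi : bounded_measurable Pi.
      apply: (@bm_random_index _ _ _ rt (fun n t => \prod_(i < n) I (th i t)) 1).
      - exact: measurable_offspring.
      - by move=> n; case: (bIn n).
      - move=> n t; rewrite ger0_norm; last first.
          by apply: prodr_ge0 => i _; case/andP: (I01 (th i t)).
        by apply: prodr_ile1 => i _; exact: I01.
    have -> : p = \int[W]_t (I t * Pi t).
      apply: bexp_ae => //; first exact: bmM.
      apply: filterS Lpos => t Lp; rewrite {1 2}/I indicE.
      have [/set_mem/= Lt|_] := boolP (_ \in _); last by rewrite mul0r.
      rewrite mul1r /Pi big1// => i _; rewrite /I indicE mem_set//=.
      exact: Lp.
    apply: bexp_le => //; first exact: bmM.
    move=> t; rewrite ler_piMl//; last by case/andP: (I01 t).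
    by apply: prodr_ge0 => i _; case/andP: (I01 (th i t)).
  move=> pfp; apply/eqP; rewrite eq_le p1 leNgt; apply/negP => plt.
  by have := fs p; rewrite sp plt => /(_ isT); rewrite ltNge pfp.
have Lgt0 : {ae W, forall t, 0 < L t}.
  exact: (proj1 (bexp_indic1_ae W mL mpos) EI).
exists (fun t => - ln (L t)); split.
- apply: measurable_funN; apply: (measurableT_comp _ mL); exact: measurable_ln.
(* If [X] vanished almost surely, [L] would be [1] almost surely, against [E[L] = s0 < 1]. *)
- move=> X0; have : \int[W]_t L t = 1.
    rewrite -[RHS](bexp_cst W); apply: bexp_ae => //; first exact: bm_cst.
    apply: filterS2 X0 Lgt0 => t /eqP; rewrite oppr_eq0 => /eqP lnL Lt.
    by rewrite -[L t]lnK ?posrE// lnL expR0.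
  rewrite EL => s01; have /andP[_] := h01 0%N.
  by rewrite h0 s01 ltxx.
have Lthgt0 := ae_subtree Lgt0.
apply: filterS (filterI (filterI UL ULth) (filterI Lgt0 Lthgt0)).
move=> t [[[_ U2] Uth] [Lt Lth]].
(* The sequence [l (phi j) * Z (phi j).+1] has two limits: [m * X] on the whole tree, and the sum of
   the [X] of the subtrees by the recursion at the root. *)
apply: (cvg_unique _ (lS t U2 Lt)) => //.
have -> : (fun j => l (phi j) * (Z (phi j).+1 t)%:R) =
    (fun j => \sum_(i < rt t) l (phi j) * (Z (phi j) (th i t))%:R).
  by apply/funext => j; rewrite ZS natr_sum mulr_sumr.
apply: cvg_big => [|i _]; first exact: add_continuous.
apply: (lcvg phi); last exact: Lth.
by have [] := Uth i.
Unshelve. all: end_near. Qed.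

End branching_limit.

(** * Construction of the stable variable and conclusion *)

Lemma ae_eq_preimage d d' (T : measurableType d) (U : measurableType d')
  (R : realType) (P : probability T R) (f g : T -> U) (A : set U) :
  measurable_fun setT f -> measurable_fun setT g -> measurable A ->
  {ae P, forall t, f t = g t} -> P (f @^-1` A) = P (g @^-1` A).
Proof.
move=> mf mg mA fg.
have mfA := measurable_preimageT mf mA; have mgA := measurable_preimageT mg mA.
rewrite -[LHS]fineK ?fin_num_measure// -[RHS]fineK ?fin_num_measure//.
rewrite -!bexp_indic//; congr (_%:E); apply: bexp_ae; [exact: bm_indic|exact: bm_indic|].
apply: filterS fg => t fgt; rewrite !indicE; congr (nat_of_bool _)%:R.
by apply/idP/idP => /set_mem /= H; apply/mem_set; rewrite /= ?fgt// -fgt.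
Qed.

(** The coin space carries everything at once: [binary_value] followed by the quantile function
    gives a copy of [N], and the stability equation holds there almost surely with [c = m], hence in
    law. *)
Lemma exists_N_stable (R : realType) d (T : measurableType d)
    (P : probability T R) (N : {RV P >-> nat}) (m : R) :
  1 < m -> ('E_P[fun t => (N t)%:R : R] = m%:E)%E ->
  exists (d' : measure_display) (T' : measurableType d')
      (P' : probability T' R) (X : {RV P' >-> R}),
    N_stable N X /\ ~ {ae P', forall t, X t = 0}.
Proof.
move=> m1 Em; have [q mq qN] := quantile_nat N.
pose W : probability coins R := coin_prob R.
pose M0 (w : coins) := q (binary_value R w).
have me := measurable_evens; have mo := measurable_odds.
have split := @coin_prob_split R.
have mM0 : measurable_fun setT M0 := measurableT_comp mq (@measurable_binary_value R).
have M0N (A : set nat) : W (M0 @^-1` A) = P (N @^-1` A).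
  by rewrite -qN -coin_prob_binary_value//; exact: measurable_preimageT.
have [X [mX X_neq0 XE]] := exists_branching_limit me mo split mM0 M0N m1 Em.
pose X' : {RV W >-> R} := mfun_Sub (mem_set mX).
have mY i : measurable_fun setT (X \o subtree evens odds i).
  exact: measurableT_comp mX (measurable_subtree me mo i).
pose Y i : {RV W >-> R} := mfun_Sub (mem_set (mY i)).
pose M : {RV W >-> nat} := mfun_Sub (mem_set (measurable_offspring me mM0)).
exists _, _, W, X'; split => //.
exists m; first exact: lt_trans m1.
exists _, _, W, M, Y; split.
- move=> A _; exact: (offspring_law split mM0 M0N A).
- by move=> i A mA; exact: (preserve_subtree me mo split i (measurable_preimageT mX mA)).
- by apply: (mutually_independent_subtree me mo split mX) => i t.
- by apply: (independent_of_subtree me mo split mM0 mX) => [i t|t].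
- move=> A mA; apply: (@ae_eq_preimage _ _ _ _ _ W (random_sum M Y) (fun t => m * X t)) => //.
  + exact: measurable_funM.
  + by apply: filterS XE => t ->.
Qed.

Theorem theorem2p1 (R : realType) (d : measure_display) (T : measurableType d)
    (P : probability T R) (N : {RV P >-> nat})
    (hN0 : ~ {ae P, forall t, N t = 0%N})
    (hN1 : ~ {ae P, forall t, N t = 1%N}) :
  (exists (d' : measure_display) (T' : measurableType d')
      (P' : probability T' R) (X : {RV P' >-> R}),
    N_stable N X /\ ~ {ae P', forall t, X t = 0}) <->
  (1 < 'E_P[fun t => (N t)%:R : R] < +oo)%E.
Proof.
split; last first.
  move=> /andP[m1 moo].
  have mfin : 'E_P[fun t => (N t)%:R : R]%E \is a fin_num.
    by rewrite ge0_fin_numE// (le_trans _ (ltW m1)).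
  apply: (exists_N_stable (m := fine 'E_P[fun t => (N t)%:R : R]%E)).
    by rewrite -lte_fin fineK.
  by rewrite fineK.
move=> [d' [T' [P' [X [[c c0 [d2 [T2 [Q [M [Y [MN YX indY indM SX]]]]]]] X0]]]]].
apply/andP; split.
  exact: (stable_expectation_gt1 indY YX MN indM c0 SX X0 hN1).
exact: (stable_expectation_lty indY YX MN indM c0 SX X0).
Qed.
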